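(* Let $G$ and $H$ be unimodular locally compact second countable groups that are coarsely equivalent. Then for every $n\ge0$, $HX^n_{(2)}(G)\cong HX^n_{(2)}(H)$ and $\underline{H}X^n_{(2)}(G)\cong \underline{H}X^n_{(2)}(H)$.
   Context: Each group is equipped with a left-invariant proper continuous metric $d$ and a Haar measure $\mu$. Coarse equivalence: a map $f\colon X\to Y$ between metric spaces is coarse Lipschitz if $d_Y(f(x),f(x'))\le a(d_X(x,x'))$ for some non-decreasing $a\colon[0,\infty)\to[0,\infty)$ with $a(t)\to\infty$; two maps are close if their pointwise distance is uniformly bounded; $f$ is a coarse equivalence if there is a coarse Lipschitz $g\colon Y\to X$ with $fg,gf$ close to the identities. Coarse $\ell^2$-cohomology of $G$: for $R>0$ let $G^{n+1}_R=\{(g_0,\dots,g_n)\in G^{n+1}: d(g_i,g_j)\le R\ \forall i,j\}$ and $\|\alpha\|_R^2=\int_{G^{n+1}_R}|\alpha|^2\,d\mu_{n+1}$ for measurable $\alpha\colon G^{n+1}\to\mathbb{C}$ ($\mu_{n+1}$ the product measure). $CX^n_{(2)}(G)$ is the Fréchet space of classes modulo null sets of measurable $\alpha$ with $\|\alpha\|_R<\infty$ for all $R>0$, with seminorms $\|\cdot\|_R$, and differential $d^{n}\alpha(g_0,\dots,g_{n+1})=\sum_{i=0}^{n+1}(-1)^i\alpha(g_0,\dots,\widehat{g_i},\dots,g_{n+1})$. $HX^n_{(2)}(G)$ is the cohomology of this complex, and $\underline{H}X^n_{(2)}(G)$ the reduced cohomology (cocycles modulo the closure of the image of the differential). Similarly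 for $H$. *)

(* Defs.v *)
From HB Require Import structures.
From mathcomp Require Import all_boot all_order all_algebra.
From mathcomp Require Import all_classical all_reals all_analysis.
From mathcomp Require Import complex.

Set Implicit Arguments.
Unset Strict Implicit.
Unset Printing Implicit Defensive.

Import Order.TTheory GRing.Theory Num.Theory.
Import numFieldNormedType.Exports.
Local Open Scope classical_set_scope.
Local Open Scope ring_scope.

Definition Borel (T : ptopologicalType) := g_sigma_algebraType (@open T).

Definition lcsc_group (T : ptopologicalType) (mul : T -> T -> T) (inv : T -> T)
    (e : T) : Prop :=
  [/\ [/\ (forall x y z, mul x (mul y z) = mul (mul x y) z),
          (forall x, mul e x = x /\ mul x e = x) &
          (forall x, mul (inv x) x = e /\ mul x (inv x) = e)],
      continuous (fun p : T * T => mul p.1 p.2) /\ continuous inv,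
      hausdorff_space T,
      locally_compact [set: T] & @second_countable T].

Definition lipc_metric (R : realType) (T : ptopologicalType)
    (mul : T -> T -> T) (d : T -> T -> R) : Prop :=
  [/\ [/\ (forall x y, 0 <= d x y), (forall x y, d x y = 0 <-> x = y),
          (forall x y, d x y = d y x) &
          (forall x y z, d x z <= d x y + d y z)],
      (forall g x y, d (mul g x) (mul g y) = d x y),
      continuous (fun p : T * T => d p.1 p.2) &
      (forall x (r : R), compact [set y | d x y <= r])].

(* mu is a Haar measure (nonzero, left invariant, finite on compact sets;
   on an lcsc group every such Borel measure is Radon) and the group is
   unimodular (mu is also right invariant).                             *)
Definition unimodular_haar (R : realType) (T : ptopologicalType)
    (mul : T -> T -> T) (mu : {measure set (Borel T) -> \bar R}) : Prop :=
  [/\ mu [set: T] != 0%E,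
      (forall K : set T, compact K -> (mu K < +oo)%E),
      (forall (g : T) (A : set (Borel T)), measurable A ->
         mu [set mul g x | x in A] = mu A) &
      (forall (g : T) (A : set (Borel T)), measurable A ->
         mu [set mul x g | x in A] = mu A)].

Definition control_function (R : realType) (a : R -> R) : Prop :=
  [/\ (forall t, 0 <= t -> 0 <= a t),
      (forall s t, 0 <= s -> s <= t -> a s <= a t) &
      a t @[t --> +oo%R] --> +oo%R].

Definition coarse_lipschitz (R : realType) (X Y : Type) (dX : X -> X -> R)
    (dY : Y -> Y -> R) (f : X -> Y) : Prop :=
  exists a : R -> R, control_function a /\
    forall x x', dY (f x) (f x') <= a (dX x x').

Definition close_maps (R : realType) (X Y : Type) (dY : Y -> Y -> R)
    (f g : X -> Y) : Prop :=
  exists C : R, forall x, dY (f x) (g x) <= C.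

Definition coarse_equivalent (R : realType) (X Y : Type) (dX : X -> X -> R)
    (dY : Y -> Y -> R) : Prop :=
  exists (f : X -> Y) (g : Y -> X),
    [/\ coarse_lipschitz dX dY f, coarse_lipschitz dY dX g,
        close_maps dX (fun x => g (f x)) id &
        close_maps dY (fun y => f (g y)) id].

(* Coarse l^2 cochains.  A (representative of an) n-cochain is a
   function G^{n+1} -> C, with G^{n+1} = 'I_n.+1 -> G.                  *)
Definition cochain (R : realType) (T : Type) (n : nat) :=
  ('I_n.+1 -> T) -> R[i].

Definition prod_sigma (T : ptopologicalType) (n : nat) : set (set ('I_n.+1 -> T)) :=
  <<s [set (fun x : 'I_n.+1 -> T => x i) @^-1` A | i in [set: 'I_n.+1] & A in
        [set A : set (Borel T) | measurable A] ] >>.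

Definition cochain_measurable (R : realType) (T : ptopologicalType) (n : nat)
    (al : cochain R T n) : Prop :=
  forall B : set R, measurable B ->
    @prod_sigma T n ((fun x => complex.Re (al x)) @^-1` B) /\
    @prod_sigma T n ((fun x => complex.Im (al x)) @^-1` B).

Definition upd (T : Type) (x : nat -> T) (k : nat) (g : T) : nat -> T :=
  fun j => if j == k then g else x j.

Fixpoint iter_int (R : realType) (T : ptopologicalType)
    (mu : {measure set (Borel T) -> \bar R}) (k : nat)
    (F : (nat -> T) -> \bar R) (x : nat -> T) : \bar R :=
  match k with
  | 0 => F x
  | k'.+1 => (\int[mu]_g iter_int mu k' F (upd x k' g))%E
  end.

(* integral of a nonnegative function on G^{n+1} against mu_{n+1}
   (Tonelli: iterated integral = integral against the product measure) *)
Definition prod_int (R : realType) (T : ptopologicalType)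
    (mu : {measure set (Borel T) -> \bar R}) (e : T) (n : nat)
    (F : ('I_n.+1 -> T) -> \bar R) : \bar R :=
  iter_int mu n.+1 (fun x => F (fun i : 'I_n.+1 => x i)) (fun _ => e).

Definition sqnorm (R : realType) (T : ptopologicalType) (e : T) (d : T -> T -> R)
    (mu : {measure set (Borel T) -> \bar R}) (n : nat) (r : R)
    (al : cochain R T n) : \bar R :=
  prod_int mu e (fun x => if `[< forall i j, d (x i) (x j) <= r >]
                          then ((complex.Re `|al x|) ^+ 2)%:E else 0%E).

Definition CX (R : realType) (T : ptopologicalType) (e : T) (d : T -> T -> R)
    (mu : {measure set (Borel T) -> \bar R}) (n : nat) : set (cochain R T n) :=
  [set al | cochain_measurable al /\
            forall r : R, 0 < r -> (sqnorm e d mu r al < +oo)%E].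

(* al = 0 in CX^n_(2)(G), i.e. al vanishes almost everywhere            *)
Definition null_cochain (R : realType) (T : ptopologicalType) (e : T)
    (d : T -> T -> R) (mu : {measure set (Borel T) -> \bar R}) (n : nat)
    (al : cochain R T n) : Prop :=
  forall r : R, 0 < r -> sqnorm e d mu r al = 0%E.

Definition dcob (R : realType) (T : Type) (n : nat) (al : cochain R T n) :
    cochain R T n.+1 :=
  fun x => \sum_(i < n.+2) (-1) ^+ i * al (fun j => x (lift i j)).

Definition csub (R : realType) (T : Type) (n : nat) (al be : cochain R T n) :
    cochain R T n := fun x => al x - be x.

Definition ZX (R : realType) (T : ptopologicalType) (e : T) (d : T -> T -> R)
    (mu : {measure set (Borel T) -> \bar R}) (n : nat) : set (cochain R T n) :=
  [set al | CX e d mu al /\ null_cochain e d mu (dcob al)].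

Definition BX (R : realType) (T : ptopologicalType) (e : T) (d : T -> T -> R)
    (mu : {measure set (Borel T) -> \bar R}) (n : nat) : set (cochain R T n) :=
  match n return set (cochain R T n) with
  | 0 => [set al | CX e d mu al /\ null_cochain e d mu al]
  | m.+1 => [set al | CX e d mu al /\
             exists be, CX e d mu be /\ null_cochain e d mu (csub al (dcob be))]
  end.

(* closure of the coboundaries in the Frechet topology of CX^n (the
   seminorms are nondecreasing in r, so the sets
   {be | ||al - be||_r < eps} form a neighbourhood basis of al)          *)
Definition BXbar (R : realType) (T : ptopologicalType) (e : T) (d : T -> T -> R)
    (mu : {measure set (Borel T) -> \bar R}) (n : nat) : set (cochain R T n) :=
  [set al | CX e d mu al /\
    forall r eps : R, 0 < r -> 0 < eps ->
      exists2 be, BX e d mu be & (sqnorm e d mu r (csub al be) < eps%:E)%E].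

Definition qsqnorm (R : realType) (T : ptopologicalType) (e : T) (d : T -> T -> R)
    (mu : {measure set (Borel T) -> \bar R}) (n : nat) (S : set (cochain R T n))
    (r : R) (al : cochain R T n) : \bar R :=
  ereal_inf [set sqnorm e d mu r (csub al be) | be in S].

(* Isomorphism of topological vector spaces  ZG / SG  ~=  ZH / SH
   (quotients of subspaces of the Frechet spaces CX^n, with the quotient
   topology given by the quotient seminorms), presented through maps of
   representatives Phi, Psi inducing mutually inverse, C-linear,
   continuous maps of the quotients.                                     *)
Definition quotient_linear (R : realType) (X Y : Type)
    (ZX SX : set (X -> R[i])) (ZY SY : set (Y -> R[i])) (Phi : (X -> R[i]) -> (Y -> R[i])) :
    Prop :=
  [/\ (forall al, ZX al -> ZY (Phi al)),
      (forall al be, ZX al -> ZX be -> SX (fun x => al x - be x) ->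
          SY (fun y => Phi al y - Phi be y)) &
      (forall al be (c : R[i]), ZX al -> ZX be ->
          SY (fun y => Phi (fun x => al x + c * be x) y - (Phi al y + c * Phi be y)))].

Definition top_iso_quot (R : realType) (TG TH : ptopologicalType)
    (eG : TG) (dG : TG -> TG -> R) (muG : {measure set (Borel TG) -> \bar R})
    (eH : TH) (dH : TH -> TH -> R) (muH : {measure set (Borel TH) -> \bar R})
    (n : nat) (ZG SG : set (cochain R TG n)) (ZH SH : set (cochain R TH n)) : Prop :=
  exists (Phi : cochain R TG n -> cochain R TH n)
         (Psi : cochain R TH n -> cochain R TG n),
  [/\ quotient_linear ZG SG ZH SH Phi /\ quotient_linear ZH SH ZG SG Psi,
      (forall al, ZG al -> SG (csub (Psi (Phi al)) al)) /\
      (forall be, ZH be -> SH (csub (Phi (Psi be)) be)),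
      (forall r : R, 0 < r -> exists r' C : R, [/\ 0 < r', 0 <= C &
         forall al, ZG al ->
           (qsqnorm eH dH muH SH r (Phi al) <= C%:E * qsqnorm eG dG muG SG r' al)%E]) &
      (forall r : R, 0 < r -> exists r' C : R, [/\ 0 < r', 0 <= C &
         forall be, ZH be ->
           (qsqnorm eG dG muG SG r (Psi be) <= C%:E * qsqnorm eH dH muH SH r' be)%E])].

Arguments CX {R T} e d mu n _.
Arguments ZX {R T} e d mu n _.
Arguments BX {R T} e d mu n _.
Arguments BXbar {R T} e d mu n _.

(* Main.v *)
(* A coarse equivalence g : H -> G is smeared out to a kernel K(h, x) on H x G:
   after moving h to the first point within distance 1 of it in a dense sequence
   of H, K(h, .) is the uniform probability density on the unit ball around its
   image.  By left invariance all unit balls have the same measure, so K is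
   bounded, and its integrals over H are bounded because g has a coarse inverse.
   Averaging a cochain against K in every variable commutes with the differential,
   and it is bounded for the seminorms by Jensen's inequality and Tonelli's theorem.

   Going from G to H and back is averaging against the composite kernel on G x G,
   which is supported near the diagonal.  This is homotopic to the identity through
     s a (x_0, .., x_n) =
       sum_j (-1)^j int a(x_0, .., x_j, z_j, .., z_n) prod_i K(x_i, z_i) dz,
   which is bounded because K is bounded: in the j-th term both x_j and z_j are
   integrated.  The integrals defining s converge only almost everywhere, so the
   homotopy identity holds away from the infinity set of an integrable function. *)
Require Import Defs.
From HB Require Import structures.
From mathcomp Require Import all_boot all_order all_algebra.
From mathcomp Require Import all_classical all_reals all_analysis.
From mathcomp Require Import measurable_realfun complex ring lra zify.
Set Implicit Arguments.
Unset Strict Implicit.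
Unset Printing Implicit Defensive.
Import Order.TTheory GRing.Theory Num.Theory.
Import numFieldNormedType.Exports.
Local Open Scope classical_set_scope.
Local Open Scope ring_scope.

(** * Iterated integrals *)

(** A coarse map may be non-measurable and may send a set of positive measure into a null set, so
    classes modulo null sets cannot simply be pulled back; this forces the smearing. In return, a
    bounded density makes the average of an l^2 cochain over all of its variables converge at every
    tuple, so averaging is an honest map of functions, exactly linear and exactly compatible with
    the differential. The homotopy lacks this: its j-th term leaves x_0, .., x_j unaveraged, and a
    slice of an l^2 function at a fixed x may fail to be integrable.

    All estimates are made on iterated integrals of nonnegative functions, where monotonicity and
    Tonelli are available before any integrability is known; signed and complex integrals enter
    afterwards as differences of such values. Cochains of all degrees are treated as functions on
    sequences [nat -> T]: there is a single measurable space, the i-th face is composition with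
    [bump i], and no transport between dimensions arises. *)

Section integral_extra.
Context {d d' : measure_display} {X : measurableType d} {T : measurableType d'}
  {R : realType}.
Local Open Scope ereal_scope.

(** The integral of a nonnegative function is the supremum over the simple functions below it, hence
    monotone for arbitrary functions, measurable or not; [le_witer] inherits this. *)
Lemma ge0_le_integralT (mu : {measure set T -> \bar R}) (f g : T -> \bar R) :
  (forall x, 0 <= f x) -> (forall x, f x <= g x) ->
  \int[mu]_x f x <= \int[mu]_x g x.
Proof.
move=> f0 fg; have g0 x : 0 <= g x by exact: le_trans (f0 x) (fg x).
rewrite !ge0_integralTE//; apply: le_ereal_sup => _ [h hf <-].
by exists h => // x; exact: le_trans (hf x) (fg x).
Qed.

Lemma measurable_integral_param (mu : {sigma_finite_measure set T -> \bar R})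
    (f : X -> T -> \bar R) :
  measurable_fun setT (fun p : X * T => f p.1 p.2) ->
  (forall x t, 0 <= f x t) -> measurable_fun setT (fun x => \int[mu]_t f x t).
Proof.
move=> mf f0.
exact: (@measurable_fun_fubini_tonelli_F _ _ _ _ _ mu (fun p => f p.1 p.2)).
Qed.

Lemma integral_exchange (nu : {sigma_finite_measure set X -> \bar R})
    (mu : {sigma_finite_measure set T -> \bar R}) (f : X -> T -> \bar R) :
  measurable_fun setT (fun p : X * T => f p.1 p.2) ->
  (forall x t, 0 <= f x t) ->
  \int[nu]_x \int[mu]_t f x t = \int[mu]_t \int[nu]_x f x t.
Proof. by move=> mf f0; rewrite (fubini_tonelli (fun p => f p.1 p.2)). Qed.

Lemma ge0_integralZlT (mu : {measure set T -> \bar R}) (f : T -> \bar R) k :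
  measurable_fun setT f -> (forall x, 0 <= f x) -> 0 <= k ->
  \int[mu]_x (k * f x) = k * \int[mu]_x f x.
Proof. by move=> mf f0 k0; rewrite ge0_integralZl. Qed.

End integral_extra.

Section coordinate_space.
Context {d : measure_display}.

(** The generators of [prod_sigma], for an arbitrary index type: ['I_n.+1] gives the sigma-algebra
    of n-cochains, [nat] one space for all degrees. *)
Definition coord_sets (I : Type) (T : measurableType d) : set (set (I -> T)) :=
  [set (fun x : I -> T => x i) @^-1` A | i in [set: I] &
    A in [set A : set T | measurable A]].
Arguments coord_sets : clear implicits.

Definition coord_space (I : Type) (T : measurableType d) :=
  g_sigma_algebraType (coord_sets I T).
HB.instance Definition _ (I : Type) (T : measurableType d) :=
  Measurable.on (coord_space I T).

Lemma measurable_coord (I : Type) (T : measurableType d) (i : I) :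
  measurable_fun setT (fun x : coord_space I T => (x i : T)).
Proof.
move=> _ B mB; rewrite setTI.
by apply: sub_sigma_algebra; exists i => //; exists B.
Qed.

Lemma measurable_to_coord (I : Type) (T : measurableType d) d'
    (X : measurableType d') (f : X -> coord_space I T) :
  (forall i, measurable_fun setT (fun x => f x i : T)) -> measurable_fun setT f.
Proof.
move=> mf; apply: (@measurability _ _ X (coord_space I T) setT f (coord_sets I T)) => //.
move=> _ [B [i _ [A mA <-] <-]].
exact: (mf i measurableT _ mA).
Qed.

Lemma measurable_upd (T : measurableType d) d' (X : measurableType d')
    (f : X -> coord_space nat T) (g : X -> T) k :
  measurable_fun setT f -> measurable_fun setT g ->
  measurable_fun setT (fun x => upd (f x) k (g x) : coord_space nat T).
Proof.
move=> mf mg; apply: measurable_to_coord => i; rewrite /upd.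
case: (i == k) => //.
exact: (measurableT_comp (@measurable_coord nat T i) mf).
Qed.

End coordinate_space.

Lemma updE (T : Type) (x : nat -> T) k t : upd x k t k = t.
Proof. by rewrite /upd eqxx. Qed.

Lemma upd_neq (T : Type) (x : nat -> T) k t i : i != k -> upd x k t i = x i.
Proof. by rewrite /upd => /negbTE->. Qed.

Lemma updC (T : Type) (x : nat -> T) k l s t : k != l ->
  upd (upd x k s) l t = upd (upd x l t) k s.
Proof.
move=> kl; apply/funext => i; rewrite /upd.
by have [->|//] := eqVneq i l; rewrite eq_sym (negbTE kl).
Qed.

Section weighted_iterated_integral.
Context {d : measure_display} {T : measurableType d} {R : realType}.
Variable mu : {sigma_finite_measure set T -> \bar R}.
Local Open Scope ereal_scope.

(** [iter_int] with a density [w i] on the i-th variable. Variable [k.-1] is integrated outermost;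
    the coordinates from [k] on keep the values of [x]. *)
Fixpoint witer (w : nat -> T -> \bar R) (k : nat)
    (F : (nat -> T) -> \bar R) (x : nat -> T) : \bar R :=
  if k is k'.+1 then \int[mu]_t (w k' t * witer w k' F (upd x k' t)) else F x.

Lemma witer_ge0 w k F x : (forall i t, 0 <= w i t) -> (forall y, 0 <= F y) ->
  0 <= witer w k F x.
Proof.
move=> w0 F0; elim: k x => //= k IH x.
by apply: integral_ge0 => t _; rewrite mule_ge0.
Qed.


(** [F] and [G] are compared only at points that keep the outer coordinates of [x] and whose
    integrated coordinates lie in the supports of the weights; elsewhere the weight kills the
    integrand. This is how support conditions on kernels enter the estimates. *)
Lemma le_witer w w' k F G x :
  (forall i t, 0 <= w i t) -> (forall i t, 0 <= w' i t) ->
  (forall y, 0 <= F y) -> (forall y, 0 <= G y) ->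
  (forall i t, (i < k)%N -> w i t <= w' i t) ->
  (forall y, (forall i, (i < k)%N -> w i (y i) != 0) ->
    (forall i, (k <= i)%N -> y i = x i) -> F y <= G y) ->
  witer w k F x <= witer w' k G x.
Proof.
move=> w0 w'0 F0 G0; elim: k x => [|k IH] x ww' FG /=; first by apply: FG.
apply: ge0_le_integralT => t; first by rewrite mule_ge0// witer_ge0.
have [wt0|wt0] := eqVneq (w k t) 0.
  by rewrite wt0 mul0e mule_ge0// witer_ge0.
apply: lee_pmul; rewrite ?witer_ge0 ?ww'//.
apply: IH => [i s ik|y wy yx]; first by rewrite ww'// ltnS ltnW.
apply: FG => i.
  by rewrite ltnS leq_eqVlt => /predU1P[->|/wy//]; rewrite yx// updE.
by move=> ki; rewrite yx ?(ltnW ki)// upd_neq// gtn_eqF.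
Qed.

Lemma eq_witer w w' k F G x :
  (forall i t, 0 <= w i t) -> (forall y, 0 <= F y) ->
  (forall i t, (i < k)%N -> w i t = w' i t) ->
  (forall i t, 0 <= w' i t) -> (forall y, 0 <= G y) ->
  (forall y, (forall i, (i < k)%N -> w i (y i) != 0) ->
    (forall i, (k <= i)%N -> y i = x i) -> F y = G y) ->
  witer w k F x = witer w' k G x.
Proof.
move=> w0 F0 ww' w'0 G0 FG; apply/eqP; rewrite eq_le; apply/andP; split.
  by apply: le_witer => // [i t ik|y *]; [rewrite ww'|rewrite FG].
apply: le_witer => // [i t ik|y wy yx]; first by rewrite ww'.
by rewrite FG// => i ik; rewrite ww'// wy.
Qed.

Lemma eq_witer_fun w k F G x : F =1 G -> witer w k F x = witer w k G x.
Proof. by move=> /funext->. Qed.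

(** The weights carry the parameter because an average at [x] integrates against the weights
    [K (x i)], and it must be measurable in [x]. *)
Lemma measurable_witer_param d' (X : measurableType d')
    (w : X -> nat -> T -> \bar R) (F : X -> (nat -> T) -> \bar R) k :
  (forall i, measurable_fun setT (fun p : X * T => w p.1 i p.2)) ->
  (forall x i t, 0 <= w x i t) ->
  measurable_fun setT (fun p : X * coord_space nat T => F p.1 p.2) ->
  (forall x y, 0 <= F x y) ->
  measurable_fun setT
    (fun p : X * coord_space nat T => witer (w p.1) k (F p.1) p.2).
Proof.
move=> mw w0 mF F0; elim: k => //= k IH.
apply: (@measurable_integral_param _ _ (X * coord_space nat T)%type _ _ _
  (fun p t => w p.1 k t * witer (w p.1) k (F p.1) (upd p.2 k t))).
  apply: emeasurable_funM.
    apply: (measurableT_comp (mw k)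
      (g := fun q : (X * coord_space nat T) * T => (q.1.1, q.2))).
    by apply: measurable_fun_pair => //; exact: measurableT_comp.
  apply: (measurableT_comp IH (g := fun q : (X * coord_space nat T) * T =>
    (q.1.1, upd q.1.2 k q.2 : coord_space nat T))).
  apply: measurable_fun_pair; first exact: measurableT_comp.
  by apply: measurable_upd => //; exact: measurableT_comp.
by move=> x t; rewrite mule_ge0// witer_ge0.
Qed.

Lemma measurable_witer w k F :
  (forall i, measurable_fun setT (w i)) -> (forall i t, 0 <= w i t) ->
  measurable_fun setT (F : coord_space nat T -> \bar R) ->
  (forall y, 0 <= F y) ->
  measurable_fun setT (witer w k F : coord_space nat T -> \bar R).
Proof.
move=> mw w0 mF F0.
have := @measurable_witer_param _ T (fun=> w) (fun=> F) k.
move=> /(_ (fun i => measurableT_comp (mw i) (measurable_snd))).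
move=> /(_ (fun=> w0) (measurableT_comp mF (measurable_snd)) (fun=> F0)) h.
exact: (measurableT_comp h (pair1_measurable point)).
Qed.

Lemma measurable_upd_const (x : nat -> T) k :
  measurable_fun setT (fun t : T => upd x k t : coord_space nat T).
Proof. by apply: measurable_upd => //; exact: measurable_cst. Qed.

Section linearity.
Variables (w : nat -> T -> \bar R) (k : nat).
Hypothesis mw : forall i, measurable_fun setT (w i).
Hypothesis w0 : forall i t, 0 <= w i t.
Variables F G : (nat -> T) -> \bar R.
Hypothesis mF : measurable_fun setT (F : coord_space nat T -> \bar R).
Hypothesis F0 : forall y, 0 <= F y.
Hypothesis mG : measurable_fun setT (G : coord_space nat T -> \bar R).
Hypothesis G0 : forall y, 0 <= G y.

Let mwF H l x : measurable_fun setT (H : coord_space nat T -> \bar R) ->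
  (forall y, 0 <= H y) ->
  measurable_fun setT (fun t => w l t * witer w l H (upd x l t)).
Proof.
move=> mH H0; apply: emeasurable_funM => //.
apply: (measurableT_comp (measurable_witer l mw w0 mH H0)).
exact: measurable_upd_const.
Qed.

Lemma witerD x :
  witer w k (fun y => F y + G y) x = witer w k F x + witer w k G x.
Proof.
elim: k x => //= l IH x; rewrite -ge0_integralD//; last 4 first.
- by move=> t _; rewrite mule_ge0// witer_ge0.
- exact: mwF.
- by move=> t _; rewrite mule_ge0// witer_ge0.
- exact: mwF.
by apply: eq_integral => t _; rewrite IH ge0_muleDr// witer_ge0.
Qed.

Lemma witerZ c x : 0 <= c ->
  witer w k (fun y => c * F y) x = c * witer w k F x.
Proof.
move=> c0; elim: k x => //= l IH x; rewrite -ge0_integralZlT//.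
- by apply: eq_integral => t _; rewrite IH muleCA.
- exact: mwF.
- by move=> t; rewrite mule_ge0// witer_ge0.
Qed.

End linearity.

Lemma witer_cst (w : nat -> T -> \bar R) k c x :
  (forall i, measurable_fun setT (w i)) -> (forall i t, 0 <= w i t) ->
  0 <= c -> (forall i, (i < k)%N -> \int[mu]_t w i t = 1) ->
  witer w k (fun=> c) x = c.
Proof.
move=> mw w0 c0; elim: k x => //= k IH x w1.
rewrite -[RHS]mule1 -(w1 k)// -ge0_integralZlT//.
by apply: eq_integral => t _; rewrite IH 1?muleC// => i ik; rewrite w1// ltnS ltnW.
Qed.

Lemma witer_cst_weight C k F x : (0 <= C)%R ->
  measurable_fun setT (F : coord_space nat T -> \bar R) -> (forall y, 0 <= F y) ->
  witer (fun _ _ => C%:E) k F x = (C ^+ k)%:E * witer (fun _ _ => 1) k F x.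
Proof.
move=> C0 mF F0; elim: k x => /= [|k IH] x; first by rewrite expr0 mul1e.
have m1 k' : measurable_fun setT (witer (fun _ _ => 1) k' F : coord_space nat T -> \bar R).
  by apply: measurable_witer => // i; exact: measurable_cst.
have F1 k' y : 0 <= witer (fun _ _ => 1) k' F y by apply: witer_ge0.
rewrite -ge0_integralZlT//; last 3 first.
- under eq_fun do rewrite mul1e.
  exact: (measurableT_comp (m1 k) (measurable_upd_const x k)).
- by move=> t; rewrite mul1e.
- by rewrite lee_fin exprn_ge0.
by apply: eq_integral => t _; rewrite IH mul1e muleA -EFinM exprS.
Qed.

End weighted_iterated_integral.

Section exchange.
Context {d d' : measure_display} {T : measurableType d} {S : measurableType d'}
  {R : realType}.
Variables (mu : {sigma_finite_measure set T -> \bar R})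
  (nu : {sigma_finite_measure set S -> \bar R}).
Local Open Scope ereal_scope.

Lemma witer_integral (w : nat -> T -> \bar R) k
    (F : (nat -> T) -> S -> \bar R) x :
  (forall i, measurable_fun setT (w i)) -> (forall i t, 0 <= w i t) ->
  measurable_fun setT (fun p : coord_space nat T * S => F p.1 p.2) ->
  (forall y s, 0 <= F y s) ->
  witer mu w k (fun y => \int[nu]_s F y s) x =
  \int[nu]_s witer mu w k (fun y => F y s) x.
Proof.
move=> mw w0 mF F0; elim: k x => //= k IH x.
have mW : measurable_fun setT (fun p : S * coord_space nat T =>
    witer mu w k (F ^~ p.1) p.2).
  apply: (@measurable_witer_param _ _ _ mu _ _ (fun=> w) (fun s y => F y s)) => //.
    by move=> i; exact: measurableT_comp.
  apply: (measurableT_comp mF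
    (g := fun p : S * coord_space nat T => (p.2, p.1))).
  exact: measurable_fun_pair.
have mW' : measurable_fun setT (fun p : T * S =>
    witer mu w k (F ^~ p.2) (upd x k p.1)).
  apply: (measurableT_comp mW (g := fun p : T * S =>
    (p.2, upd x k p.1 : coord_space nat T))).
  apply: measurable_fun_pair => //.
  exact: (measurableT_comp (measurable_upd_const x k)).
rewrite -integral_exchange//; last 2 first.
- by apply: emeasurable_funM => //; exact: measurableT_comp.
- by move=> t s; rewrite mule_ge0// witer_ge0.
apply: eq_integral => t _; rewrite IH ge0_integralZlT//.
- exact: (measurableT_comp mW' (pair1_measurable t)).
- by move=> s; rewrite witer_ge0.
Qed.

End exchange.

(** * Inserting and deleting one variable *)

Section coordinate_insertion.
Context {d : measure_display} {T : measurableType d}.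

Definition insc (i : nat) (t : T) (y : nat -> T) : nat -> T :=
  fun l => if (l < i)%N then y l else if l == i then t else y l.-1.

Lemma insc_at i t y : insc i t y i = t.
Proof. by rewrite /insc ltnn eqxx. Qed.

Lemma insc_bump i t y : insc i t y \o bump i = y.
Proof.
apply/funext => l; rewrite /insc /bump /=; case: (leqP i l) => [il|li].
  by rewrite add1n ltnNge leqW//= gtn_eqF//= ltnS.
by rewrite add0n li.
Qed.

Lemma bump_insc i (z : nat -> T) t : insc i t (z \o bump i) = upd z i t.
Proof.
apply/funext => l; rewrite /insc /upd /bump /=; case: (ltngtP l i) => // il.
by case: l il => //= l; rewrite ltnS => ->.
Qed.

Lemma insc_upd i t y l s : (l < i)%N ->
  insc i t (upd y l s) = upd (insc i t y) l s.
Proof.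
move=> li; apply/funext => m; rewrite /insc /upd.
case: (ltngtP m i) => [//|im|->]; last by rewrite gtn_eqF.
by have -> : (m == l) = false; [lia|have -> : (m.-1 == l) = false by lia].
Qed.

Lemma upd_bump_ge i (z : nat -> T) l s : (i <= l)%N ->
  upd z l.+1 s \o bump i = upd (z \o bump i) l s.
Proof.
move=> il; apply/funext => m; rewrite /upd /bump /=.
case: (leqP i m) => im; first by rewrite add1n eqSS.
by have -> : (m == l) = false; [lia|have -> : (0 + m == l.+1)%N = false by lia].
Qed.

Lemma measurable_insc i : measurable_fun setT
  (fun p : coord_space nat T * T => insc i p.2 p.1 : coord_space nat T).
Proof.
apply: measurable_to_coord => l; rewrite /insc.
case: (l < i)%N.
  apply: (measurableT_comp (@measurable_coord _ nat T l)
    (g := fun p : coord_space nat T * T => p.1)); exact: measurable_fst.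
case: (l == i); first exact: measurable_snd.
apply: (measurableT_comp (@measurable_coord _ nat T l.-1)
  (g := fun p : coord_space nat T * T => p.1)); exact: measurable_fst.
Qed.

Lemma measurable_bump i : measurable_fun setT
  (fun x : coord_space nat T => x \o bump i : coord_space nat T).
Proof. by apply: measurable_to_coord => l; exact: measurable_coord. Qed.

End coordinate_insertion.

Section extraction.
Context {d : measure_display} {T : measurableType d} {R : realType}.
Variable mu : {sigma_finite_measure set T -> \bar R}.
Local Open Scope ereal_scope.

Lemma witer_insc w i t m F y : (m <= i)%N ->
  witer mu w m (fun z => F (insc i t z)) y = witer mu w m F (insc i t y).
Proof.
elim: m y => //= m IH y mi; apply: eq_integral => s _.
by rewrite IH ?(ltnW mi)// insc_upd.
Qed.

(** Any variable can be made the innermost one: variables above [i] are passed by renumbering, those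
    below [i] by Tonelli. *)
Lemma witer_extract w k i F z : (i <= k)%N ->
  (forall i, measurable_fun setT (w i)) -> (forall i t, 0 <= w i t) ->
  measurable_fun setT (F : coord_space nat T -> \bar R) -> (forall y, 0 <= F y) ->
  witer mu w k.+1 F z =
  witer mu (w \o bump i) k (fun y => \int[mu]_t (w i t * F (insc i t y)))
    (z \o bump i).
Proof.
move=> + mw w0 mF F0; elim: k z => [|k IH] z; rewrite leq_eqVlt => /predU1P[ik|].
- rewrite ik /=; apply: eq_integral => t _; congr (_ * F _).
  by rewrite -bump_insc.
- by rewrite ltn0.
- have mFi : measurable_fun setT (fun p : coord_space nat T * T =>
      w i p.2 * F (insc i p.2 p.1)).
    apply: emeasurable_funM; first exact: (measurableT_comp (mw i) measurable_snd).
    exact: (measurableT_comp mF (measurable_insc i)).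
  rewrite -ik witer_integral//; last 3 first.
  + by move=> j; exact: mw.
  + by move=> j t; exact: w0.
  + by move=> y t; rewrite mule_ge0.
  rewrite [LHS]/=; apply: eq_integral => t _.
  transitivity (witer mu w i (fun y => w i t * F (insc i t y)) (z \o bump i)).
    rewrite witerZ//; first by rewrite (witer_insc _ _ F)// bump_insc.
    exact: (measurableT_comp mF
      (measurableT_comp (measurable_insc i) (pair2_measurable t))).
  apply: eq_witer => // [y|j s ji|j s|y]; rewrite ?mule_ge0//=.
  by rewrite /bump leqNgt ji.
rewrite ltnS => ik; rewrite [LHS]/= [RHS]/=; apply: eq_integral => t _.
have -> : bump i k = k.+1 by rewrite /bump ik.
by rewrite -[X in _ * X = _]/(witer mu w k.+1 F _) IH// upd_bump_ge.
Qed.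

(** A face does not see its [i]-th vertex, which therefore integrates out with total weight 1. This
    is why averaging commutes with the differential. *)
Lemma witer_bump w k i F z : (i <= k)%N ->
  (forall i, measurable_fun setT (w i)) -> (forall i t, 0 <= w i t) ->
  \int[mu]_t w i t = 1 ->
  measurable_fun setT (F : coord_space nat T -> \bar R) -> (forall y, 0 <= F y) ->
  witer mu w k.+1 (fun y => F (y \o bump i)) z =
  witer mu (w \o bump i) k F (z \o bump i).
Proof.
move=> ik mw w0 w1 mF F0; rewrite (@witer_extract _ _ i)//; last first.
  exact: (measurableT_comp mF (measurable_bump i)).
apply: eq_witer_fun => y; under eq_integral do rewrite insc_bump muleC.
by rewrite ge0_integralZlT// w1 mule1.
Qed.

End extraction.

(** * Double iterated integrals *)

Section pair_iteration.
Context {d d' : measure_display} {S : measurableType d} {T : measurableType d'}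
  {R : realType}.
Variables (nu : {sigma_finite_measure set S -> \bar R})
  (mu : {sigma_finite_measure set T -> \bar R}).
Local Open Scope ereal_scope.
Variables (v : nat -> S -> \bar R) (K : S -> T -> \bar R).
Hypothesis mv : forall i, measurable_fun setT (v i).
Hypothesis v0 : forall i s, 0 <= v i s.
Hypothesis mK : measurable_fun setT (fun p : S * T => K p.1 p.2).
Hypothesis K0 : forall s t, 0 <= K s t.

(** The double integral over all [s] and all [t], arranged pair by pair so that an estimate can
    treat [(s_k, t_k)] in one induction step. *)
Fixpoint piter (k : nat) (F : (nat -> S) -> (nat -> T) -> \bar R) y z : \bar R :=
  if k is k'.+1 then
    \int[nu]_s (v k' s * \int[mu]_t (K s t * piter k' F (upd y k' s) (upd z k' t)))
  else F y z.

Lemma piter_ge0 k F y z : (forall y z, 0 <= F y z) -> 0 <= piter k F y z.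
Proof.
move=> F0; elim: k y z => //= k IH y z; apply: integral_ge0 => s _.
by rewrite mule_ge0//; apply: integral_ge0 => t _; rewrite mule_ge0.
Qed.

Lemma measurable_kernel_coord i (y : nat -> S) : measurable_fun setT (K (y i)).
Proof. exact: (measurableT_comp mK (pair1_measurable (y i))). Qed.

Lemma measurable_witer_kernel k (F : (nat -> S) -> (nat -> T) -> \bar R) :
  measurable_fun setT (fun p : coord_space nat S * coord_space nat T => F p.1 p.2) ->
  (forall y z, 0 <= F y z) ->
  measurable_fun setT (fun p : coord_space nat S * coord_space nat T =>
    witer mu (fun i => K (p.1 i)) k (F p.1) p.2).
Proof.
move=> mF F0.
apply: (@measurable_witer_param _ _ _ mu _ (coord_space nat S)
  (fun y i => K (y i)) F) => //.
move=> i; apply: (measurableT_comp mK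
  (g := fun p : coord_space nat S * T => (p.1 i, p.2))).
apply: measurable_fun_pair => //.
exact: (measurableT_comp (@measurable_coord _ nat S i)).
Qed.

(** The weight [K (y k)] of [t_k] sees only [s_k], so the integral over [t_k] moves out past those
    over [s_0, .., s_(k-1)]. *)
Lemma witer_witer k (F : (nat -> S) -> (nat -> T) -> \bar R) y z :
  measurable_fun setT (fun p : coord_space nat S * coord_space nat T => F p.1 p.2) ->
  (forall y z, 0 <= F y z) ->
  witer nu v k (fun y => witer mu (fun i => K (y i)) k (F y) z) y = piter k F y z.
Proof.
move=> mF F0; elim: k y z => //= k IH y z; apply: eq_integral => s _.
congr (_ * _); have mW := measurable_witer_kernel k mF F0.
have mU : measurable_fun setT (fun p : coord_space nat S * T =>
    witer mu (fun i => K (p.1 i)) k (F p.1) (upd z k p.2)).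
  apply: (measurableT_comp mW (g := fun p : coord_space nat S * T =>
    (p.1, upd z k p.2 : coord_space nat T))).
  apply: measurable_fun_pair => //.
  exact: (measurableT_comp (measurable_upd_const z k)).
have mKk : measurable_fun setT (fun p : coord_space nat S * T => K (p.1 k) p.2).
  apply: (measurableT_comp mK (g := fun p : coord_space nat S * T => (p.1 k, p.2))).
  apply: measurable_fun_pair => //.
  exact: (measurableT_comp (@measurable_coord _ nat S k)).
rewrite witer_integral//; last 2 first.
- exact: emeasurable_funM.
- by move=> x t; rewrite mule_ge0// witer_ge0.
apply: eq_integral => t _; rewrite -IH -witerZ//; last 2 first.
- exact: (measurableT_comp mU (pair2_measurable t)).
- by move=> x; rewrite witer_ge0.
apply: eq_witer => // [x|x|x wx xu]; rewrite ?mule_ge0 ?witer_ge0//.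
by rewrite xu// updE.
Qed.

(** Since [F] ignores [s], each [s_k] integrates out and leaves a marginal of [K] as the weight of
    [t_k]. *)
Lemma piter_snd k (F : (nat -> T) -> \bar R) y z :
  measurable_fun setT (F : coord_space nat T -> \bar R) -> (forall z, 0 <= F z) ->
  piter k (fun _ => F) y z =
  witer mu (fun i t => \int[nu]_s (v i s * K s t)) k F z.
Proof.
move=> mF F0.
have mvK i : measurable_fun setT (fun p : T * S => v i p.2 * K p.2 p.1).
  apply: emeasurable_funM; first exact: measurableT_comp.
  apply: (measurableT_comp mK (g := fun p : T * S => (p.2, p.1))).
  exact: measurable_fun_pair.
have vK0 i t s : 0 <= v i s * K s t by rewrite mule_ge0.
have mW k' : measurable_fun setT (witer mu
    (fun i t => \int[nu]_s (v i s * K s t)) k' F : coord_space nat T -> \bar R).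
  apply: measurable_witer => // i.
    exact: (measurable_integral_param _ (mvK i)).
  by move=> t; exact: integral_ge0.
have W0 k' z' : 0 <= witer mu (fun i t => \int[nu]_s (v i s * K s t)) k' F z'.
  by apply: witer_ge0 => // i t; exact: integral_ge0.
elim: k y z => //= k IH y z.
under eq_integral => s _.
  under eq_integral do rewrite IH.
  rewrite -ge0_integralZlT//; last 2 first.
  - apply: emeasurable_funM; first exact: (measurable_kernel_coord 0 (fun=> s)).
    exact: (measurableT_comp (mW k) (measurable_upd_const z k)).
  - by move=> t; rewrite mule_ge0.
  over.
rewrite integral_exchange//; last 2 first.
- apply: emeasurable_funM; first exact: measurableT_comp.
  apply: emeasurable_funM => //.
  apply: (measurableT_comp (mW k) (g := fun p : S * T => upd z k p.2 : coord_space nat T)).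
  exact: (measurableT_comp (measurable_upd_const z k)).
- by move=> s t; rewrite !mule_ge0.
apply: eq_integral => t _.
rewrite muleC -ge0_integralZlT//; last 1 first.
  exact: (measurableT_comp (mvK k) (pair1_measurable t)).
by apply: eq_integral => s _; rewrite muleA muleC.
Qed.

End pair_iteration.

(** * Prisms and controlled tuples *)

Section prism_estimate.
Context {d : measure_display} {T : measurableType d} {R : realType}.
Variable mu : {sigma_finite_measure set T -> \bar R}.
Local Open Scope ereal_scope.

(* The vertices (x_0, .., x_j, z_j, z_(j+1), ..) of the prism over x and z. *)
Definition prism (j : nat) (x z : nat -> T) : nat -> T :=
  fun l => if (l <= j)%N then x l else z l.-1.

(** Of the pair [(x_k, z_k)] the prism keeps [x_k] when [k < j], [z_k] in place [k.+1] when [k > j],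
    and both when [k = j]; the three update rules record this. *)
Lemma prism_upd_lt j x z k s t : (k < j)%N ->
  prism j (upd x k s) (upd z k t) = upd (prism j x z) k s.
Proof.
move=> kj; apply/funext => l; rewrite /prism /upd; case: (leqP l j) => // jl.
by have -> : (l.-1 == k) = false; [lia|have -> : (l == k) = false by lia].
Qed.

Lemma prism_upd_eq j x z s t :
  prism j (upd x j s) (upd z j t) = upd (upd (prism j x z) j s) j.+1 t.
Proof.
apply/funext => l; rewrite /prism /upd; case: (ltngtP l j) => jl.
- by have -> : (l == j.+1) = false by lia.
- have -> : (l.-1 == j) = (l == j.+1) by lia.
  by case: eqP.
- by have -> : (l == j.+1) = false by lia.
Qed.

Lemma prism_upd_gt j x z k s t : (j < k)%N ->
  prism j (upd x k s) (upd z k t) = upd (prism j x z) k.+1 t.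
Proof.
move=> kj; apply/funext => l; rewrite /prism /upd; case: (leqP l j) => jl.
  by have -> : (l == k) = false; [lia|have -> : (l == k.+1) = false by lia].
by have -> : (l.-1 == k) = (l == k.+1) by lia.
Qed.

Lemma measurable_prism j : measurable_fun setT
  (fun p : coord_space nat T * coord_space nat T =>
    prism j p.1 p.2 : coord_space nat T).
Proof.
apply: measurable_to_coord => l; rewrite /prism; case: (l <= j)%N.
  apply: (measurableT_comp (@measurable_coord _ nat T l)
    (g := fun p : coord_space nat T * coord_space nat T => p.1)).
  exact: measurable_fst.
apply: (measurableT_comp (@measurable_coord _ nat T l.-1)
  (g := fun p : coord_space nat T * coord_space nat T => p.2)).
exact: measurable_snd.
Qed.

Variables (K : T -> T -> \bar R) (C : R).
Hypothesis mK : measurable_fun setT (fun p : T * T => K p.1 p.2).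
Hypothesis K0 : forall s t, 0 <= K s t.
Hypothesis KC : forall s t, K s t <= C%:E.
Hypothesis intKl : forall s, \int[mu]_t K s t <= C%:E.
Hypothesis intKr : forall t, \int[mu]_s K s t <= C%:E.

Let C0 : 0 <= C%:E. Proof. exact: le_trans (K0 point point) (KC _ _). Qed.

Let mKl s : measurable_fun setT (K s).
Proof. exact: (measurableT_comp mK (pair1_measurable s)). Qed.

Let mKr t : measurable_fun setT (K ^~ t).
Proof. exact: (measurableT_comp mK (pair2_measurable t)). Qed.

(** The one-step bounds match the three rules for [prism]: an integrand in [s] alone uses the mass
    of [K s], one in [t] alone the mass of [K ^~ t], and one in both variables the supremum of
    [K]. *)
Let one_step_l (a : T -> \bar R) : measurable_fun setT a -> (forall s, 0 <= a s) ->
  \int[mu]_s (1 * \int[mu]_t (K s t * a s)) <= C%:E * \int[mu]_s a s.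
Proof.
move=> ma a0; rewrite -ge0_integralZlT//; apply: ge0_le_integralT => s.
  by rewrite mul1e; apply: integral_ge0 => t _; rewrite mule_ge0.
rewrite mul1e; under eq_integral do rewrite muleC.
by rewrite ge0_integralZlT// muleC lee_wpmul2r.
Qed.

Let one_step_r (a : T -> \bar R) : measurable_fun setT a -> (forall s, 0 <= a s) ->
  \int[mu]_s (1 * \int[mu]_t (K s t * a t)) <= C%:E * \int[mu]_s a s.
Proof.
move=> ma a0; under eq_integral do rewrite mul1e.
rewrite integral_exchange//; last 2 first.
- by apply: emeasurable_funM => //; exact: measurableT_comp.
- by move=> s t; rewrite mule_ge0.
rewrite -ge0_integralZlT//; apply: ge0_le_integralT => t.
  by apply: integral_ge0 => s _; rewrite mule_ge0.
under eq_integral do rewrite muleC.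
by rewrite ge0_integralZlT// muleC lee_wpmul2r.
Qed.

Let one_step_lr (a : T -> T -> \bar R) :
  measurable_fun setT (fun p : T * T => a p.1 p.2) -> (forall s t, 0 <= a s t) ->
  \int[mu]_s (1 * \int[mu]_t (K s t * a s t)) <=
  C%:E * \int[mu]_t \int[mu]_s a s t.
Proof.
move=> ma a0; rewrite -integral_exchange// -ge0_integralZlT//; last 2 first.
- exact: measurable_integral_param.
- by move=> s; exact: integral_ge0.
apply: ge0_le_integralT => s.
  by rewrite mul1e; apply: integral_ge0 => t _; rewrite mule_ge0.
rewrite mul1e -ge0_integralZlT//; last first.
  exact: (measurableT_comp ma (pair1_measurable s)).
by apply: ge0_le_integralT => t; [rewrite mule_ge0|rewrite lee_wpmul2r].
Qed.

(** Each pair costs a factor [C]. After [k] pairs the prism has [k] integrated vertices, and one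
    more once the pair [j], which contributes two, is among them. *)
Lemma piter_prism k j (F : (nat -> T) -> \bar R) x z :
  measurable_fun setT (F : coord_space nat T -> \bar R) -> (forall y, 0 <= F y) ->
  piter mu mu (fun _ _ => 1) K k (fun x z => F (prism j x z)) x z <=
  (C ^+ k)%:E * witer mu (fun _ _ => 1) (k + (j < k))%N F (prism j x z).
Proof.
move=> mF F0; pose W l := witer mu (fun _ _ => 1) l F.
have mW l : measurable_fun setT (W l : coord_space nat T -> \bar R).
  by apply: measurable_witer => // i; exact: measurable_cst.
have W0 l y : 0 <= W l y by apply: witer_ge0.
have C0' : (0 <= C)%R by rewrite -lee_fin.
have Ck l : 0 <= (C ^+ l)%:E :> \bar R by rewrite lee_fin exprn_ge0.
elim: k x z => [|k IH] x z; first by rewrite ltn0 addn0 expr0 mul1e.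
rewrite [X in X <= _]/=.
pose P s t := W (k + (j < k))%N (prism j (upd x k s) (upd z k t)).
have P0 s t : 0 <= (C ^+ k)%:E * P s t by apply: mule_ge0 => //; exact: W0.
apply: (@le_trans _ _ (\int[mu]_s (1 * \int[mu]_t (K s t * ((C ^+ k)%:E * P s t))))).
  have pi0 s t : 0 <= piter mu mu (fun _ _ => 1) K k (fun x z => F (prism j x z))
      (upd x k s) (upd z k t) by apply: piter_ge0.
  apply: ge0_le_integralT => s; rewrite !mul1e.
    by apply: integral_ge0 => t _; rewrite mule_ge0.
  by apply: ge0_le_integralT => t; rewrite ?mule_ge0// lee_wpmul2l.
have mWu l m : measurable_fun setT (fun s => (C ^+ k)%:E * W m (upd (prism j x z) l s)).
  apply: measurable_funeM.
  exact: (measurableT_comp (mW m) (measurable_upd_const _ l)).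
have W0u m y : 0 <= (C ^+ k)%:E * W m y by rewrite mule_ge0.
rewrite exprS EFinM -muleA.
rewrite {P0}/P; case: (ltngtP k j) => jk.
- have -> : (j < k.+1)%N = false by lia.
  under eq_integral => s _ do under eq_integral => t _ do rewrite prism_upd_lt//.
  rewrite !addn0; apply: le_trans (one_step_l (mWu k k) _) _ => //.
  rewrite ge0_integralZlT//; first by under [X in _ <= _ * (_ * X)]eq_integral do rewrite mul1e.
  exact: (measurableT_comp (mW k) (measurable_upd_const _ k)).
- have -> : (j < k.+1)%N by lia.
  under eq_integral => s _ do under eq_integral => t _ do rewrite prism_upd_gt//.
  rewrite !addn1; apply: le_trans (one_step_r (mWu k.+1 k.+1) _) _ => //.
  rewrite ge0_integralZlT//.
    by under [X in _ <= _ * (_ * X)]eq_integral do rewrite mul1e.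
  exact: (measurableT_comp (mW k.+1) (measurable_upd_const _ k.+1)).
- rewrite -jk ltnSn addn0 addn1.
  under eq_integral => s _ do under eq_integral => t _ do rewrite prism_upd_eq.
  have mWuu : measurable_fun setT (fun p : T * T =>
      W k (upd (upd (prism k x z) k p.1) k.+1 p.2)).
    apply: (measurableT_comp (mW k) (g := fun p : T * T =>
      upd (upd (prism k x z) k p.1) k.+1 p.2 : coord_space nat T)).
    apply: measurable_upd => //.
    exact: (measurableT_comp (measurable_upd_const _ k)).
  apply: le_trans (@one_step_lr (fun s t => (C ^+ k)%:E *
    W k (upd (upd (prism k x z) k s) k.+1 t)) _ _) _ => //.
    exact: measurable_funeM.
  rewrite lee_wpmul2l// [X in _ <= _ * X]/=.
  under [X in _ <= _ * X]eq_integral => t _ do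
    (under eq_integral => s _ do (rewrite mul1e updC ?gtn_eqF//); rewrite mul1e).
  rewrite -ge0_integralZlT//; last 2 first.
  + apply: (@measurable_integral_param _ _ T T R mu
      (fun t s => W k (upd (upd (prism k x z) k s) k.+1 t))) => //.
    apply: (measurableT_comp mWuu (g := fun p : T * T => (p.2, p.1))).
    exact: measurable_fun_pair.
  + by move=> t; apply: integral_ge0 => s _; exact: W0.
  have E t : \int[mu]_s ((C ^+ k)%:E * W k (upd (upd (prism k x z) k s) k.+1 t)) =
      (C ^+ k)%:E * \int[mu]_s W k (upd (upd (prism k x z) k s) k.+1 t).
    rewrite ge0_integralZlT//.
    exact: (measurableT_comp mWuu (pair2_measurable t)).
  by rewrite (eq_integral _ _ (fun t _ => E t)).
Qed.

End prism_estimate.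

Section controlled_tuples.
Context {d : measure_display} {T : measurableType d} {R : realType}.
Variable dist : T -> T -> R.
Hypothesis mdist : measurable_fun setT (fun p : T * T => dist p.1 p.2).
Local Open Scope ereal_scope.

Definition near_tuple (r : R) (n : nat) (x : nat -> T) : Prop :=
  forall i j, (i <= n)%N -> (j <= n)%N -> (dist (x i) (x j) <= r)%R.

Definition cut (r : R) (n : nat) (F : (nat -> T) -> \bar R) (x : nat -> T) :
  \bar R := if `[< near_tuple r n x >] then F x else 0.

Lemma cut_ge0 r n F x : (forall y, 0 <= F y) -> 0 <= cut r n F x.
Proof. by rewrite /cut; case: ifP. Qed.

Lemma measurable_ball x (r : R) : measurable [set y | (dist x y <= r)%R].
Proof.
have := measurableT_comp mdist (pair1_measurable x).
move=> /(_ measurableT _ (measurable_itv `]-oo, r])); rewrite setTI.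
rewrite (_ : _ @^-1` _ = [set y | (dist x y <= r)%R])//.
Qed.

Lemma measurable_near_tuple r n :
  measurable [set x : coord_space nat T | near_tuple r n x].
Proof.
rewrite (_ : [set x | _] = \bigcap_i \bigcap_j [set x : coord_space nat T |
  (i <= n)%N -> (j <= n)%N -> (dist (x i) (x j) <= r)%R]); last first.
  apply/seteqP; split => x /= h; first by move=> i _ j _ /=; exact: h.
  by move=> i j; exact: (h i I j I).
apply: bigcapT_measurable => i; apply: bigcapT_measurable => j.
have [[im jm]|nij] := pselect ((i <= n)%N /\ (j <= n)%N); last first.
  rewrite (_ : [set x | _] = setT); first exact: measurableT.
  by apply/seteqP; split => x //= _ im jm; exfalso; apply: nij.
have mc : measurable_fun setT (fun x : coord_space nat T => dist (x i) (x j)).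
  apply: (measurableT_comp mdist (g := fun x : coord_space nat T => (x i, x j))).
  by apply: measurable_fun_pair; exact: measurable_coord.
have := mc measurableT _ (measurable_itv `]-oo, r]); rewrite setTI.
congr measurable; apply/seteqP; split => y /=; rewrite in_itv/=.
  by move=> h _ _.
by move=> h; exact: h.
Qed.

Lemma measurable_cut r n F :
  measurable_fun setT (F : coord_space nat T -> \bar R) ->
  measurable_fun setT (cut r n F : coord_space nat T -> \bar R).
Proof.
move=> mF; apply: measurable_fun_ifT => //.
apply: (measurable_fun_bool true); rewrite setTI.
rewrite (_ : _ @^-1` _ = [set x : coord_space nat T | near_tuple r n x]).
  exact: measurable_near_tuple.
by apply/seteqP; split => x /= /asboolP.
Qed.

Variable mu : {sigma_finite_measure set T -> \bar R}.

(** The vertex deleted by the face lies within [r] of every other vertex. Extracted as the innermost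
    variable, it ranges over a ball, whose measure is at most [C]. *)
Lemma witer_face r n i C F z : (i <= n.+1)%N ->
  measurable_fun setT (F : coord_space nat T -> \bar R) -> (forall y, 0 <= F y) ->
  (forall x, mu [set y | (dist x y <= r)%R] <= C%:E) ->
  witer mu (fun _ _ => 1) n.+2 (cut r n.+1 (fun x => F (x \o bump i))) z <=
  C%:E * witer mu (fun _ _ => 1) n.+1 (cut r n F) (z \o bump i).
Proof.
move=> ik mF F0 bC.
have C0 : 0 <= C%:E by exact: le_trans (measure_ge0 _ _) (bC point).
have mc := measurable_cut r n mF.
have m1 : forall i : nat, measurable_fun setT (fun _ : T => 1 : \bar R).
  by move=> _; exact: measurable_cst.
rewrite (@witer_extract _ _ _ mu _ _ i)//; last 2 first.
- apply: measurable_cut; exact: (measurableT_comp mF (measurable_bump i)).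
- by move=> y; exact: cut_ge0.
rewrite -witerZ//; last by move=> y; exact: cut_ge0.
apply: le_witer => //.
- move=> y; apply: integral_ge0 => t _; rewrite mul1e; exact: cut_ge0.
- by move=> y; rewrite mule_ge0// cut_ge0.
move=> y _ _.
apply: (@le_trans _ _ (\int[mu]_t (cut r n F y *
    (\1_[set t | (dist (y 0%N) t <= r)%R] t)%:E))).
  apply: ge0_le_integralT => t; rewrite mul1e; first exact: cut_ge0.
  rewrite {1}/cut; case: asboolP => nt; last first.
    by rewrite mule_ge0// ?cut_ge0// lee_fin.
  rewrite insc_bump /cut; case: asboolP => ny; last first.
    exfalso; apply: ny => a b an bn.
    have ev l : y l = insc i t y (bump i l) by rewrite -[in LHS](insc_bump i t y).
    by rewrite !ev; apply: nt; rewrite /bump; lia.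
  rewrite indicE mem_set ?mule1//=.
  (* Vertex 0 of the face is vertex [bump i 0], that is 0 or 1, of the full tuple, and never the
     inserted vertex [i]. *)
  have -> : y 0%N = insc i t y (bump i 0) by rewrite -[in LHS](insc_bump i t y).
  by rewrite -{2}(insc_at i t y); apply: nt => //; rewrite /bump; lia.
have mB : measurable [set t | (dist (y 0%N) t <= r)%R] by exact: measurable_ball.
rewrite ge0_integralZlT ?cut_ge0//; last exact/measurable_EFinP/measurable_indic.
by rewrite integral_indic// setIT muleC lee_wpmul2r ?cut_ge0//; exact: bC.
Qed.

End controlled_tuples.

(** * Signed and complex integration *)

Section complex_square_modulus.
Variable R : realType.
Implicit Types z c : R[i].

Definition nsq z : R := complex.Re z ^+ 2 + complex.Im z ^+ 2.

Lemma nsq_ge0 z : 0 <= nsq z.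
Proof. by rewrite addr_ge0// sqr_ge0. Qed.

Lemma nsqE z : complex.Re `|z| ^+ 2 = nsq z.
Proof. by case: z => a b; rewrite /nsq /= sqr_sqrtr// addr_ge0// sqr_ge0. Qed.

Lemma ReD z c : complex.Re (z + c) = complex.Re z + complex.Re c.
Proof. by case: z; case: c. Qed.

Lemma ImD z c : complex.Im (z + c) = complex.Im z + complex.Im c.
Proof. by case: z; case: c. Qed.

Lemma ReN z : complex.Re (- z) = - complex.Re z.
Proof. by case: z. Qed.

Lemma ImN z : complex.Im (- z) = - complex.Im z.
Proof. by case: z. Qed.

Lemma ReM z c :
  complex.Re (z * c) = complex.Re z * complex.Re c - complex.Im z * complex.Im c.
Proof. by case: z; case: c. Qed.

Lemma ImM z c :
  complex.Im (z * c) = complex.Re z * complex.Im c + complex.Im z * complex.Re c.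
Proof. by case: z; case: c. Qed.

Lemma nsq0 : nsq 0 = 0.
Proof. by rewrite /nsq /= expr0n addr0. Qed.

Lemma nsqM z c : nsq (z * c) = nsq z * nsq c.
Proof. by rewrite /nsq ReM ImM; ring. Qed.

Lemma nsqN z : nsq (- z) = nsq z.
Proof. by rewrite /nsq ReN ImN !sqrrN. Qed.

Lemma nsq_sign n : nsq ((-1) ^+ n) = 1.
Proof.
elim: n => [|n IH]; first by rewrite expr0 /nsq /= expr1n expr0n addr0.
by rewrite exprS nsqM IH mulr1 nsqN /nsq /= expr1n expr0n addr0.
Qed.

Lemma nsqD_le z c : nsq (z + c) <= 2 * (nsq z + nsq c).
Proof.
rewrite /nsq ReD ImD; move: (complex.Re z) (complex.Im z) => a b.
move: (complex.Re c) (complex.Im c) => a' b'.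
have := sqr_ge0 (a - a'); have := sqr_ge0 (b - b'); nra.
Qed.

(** Each summand split off doubles the constant; any constant depending only on [n] will do. *)
Lemma nsq_sum_le n (f : 'I_n -> R[i]) :
  nsq (\sum_i f i) <= 2 ^+ n * \sum_i nsq (f i).
Proof.
elim: n f => [|n IH] f; first by rewrite !big_ord0 nsq0 mulr0.
rewrite !big_ord_recl; apply: le_trans (nsqD_le _ _) _.
rewrite exprS -mulrA ler_pM2l// mulrDr lerD//.
by rewrite ler_peMl ?nsq_ge0// exprn_ege1// ler1n.
Qed.

End complex_square_modulus.

(* Daniell-style integration of signed and complex functions against a positive
   functional that is only given on nonnegative functions. *)
Section positive_functional.
Context {d : measure_display} {X : measurableType d} {R : realType}.
Local Open Scope ereal_scope.

Record positive_functional (E : (X -> \bar R) -> \bar R) : Prop := {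
  pfun_ge0 : forall f, (forall x, 0 <= f x) -> 0 <= E f;
  pfun_le : forall f g, (forall x, 0 <= f x) -> (forall x, f x <= g x) ->
    E f <= E g;
  pfunD : forall f g, measurable_fun setT f -> measurable_fun setT g ->
    (forall x, 0 <= f x) -> (forall x, 0 <= g x) ->
    E (fun x => f x + g x) = E f + E g;
  pfunZ : forall f (c : R), measurable_fun setT f -> (forall x, 0 <= f x) ->
    (0 <= c)%R -> E (fun x => c%:E * f x) = c%:E * E f }.

Variable E : (X -> \bar R) -> \bar R.

(** [fine] sends an infinite value to 0, so [sE] is total; it is a genuine integral when both parts
    are finite, as [sint] guarantees. *)
Definition sE (f : X -> R) : R :=
  fine (E (fun x => (f^\+ x)%R%:E)) - fine (E (fun x => (f^\- x)%R%:E)).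

Definition sint (f : X -> R) : Prop :=
  measurable_fun setT f /\ E (fun x => `|f x|%:E) < +oo.

Definition cE (f : X -> R[i]) : R[i] :=
  (sE (@complex.Re R \o f) +i* sE (@complex.Im R \o f))%C.

Definition cmeas (f : X -> R[i]) : Prop :=
  measurable_fun setT (@complex.Re R \o f) /\ measurable_fun setT (@complex.Im R \o f).

Definition cint (f : X -> R[i]) : Prop :=
  sint (@complex.Re R \o f) /\ sint (@complex.Im R \o f).

Hypothesis pE : positive_functional E.

Let posBneg (f : X -> R) x : (f x = f^\+ x - f^\- x)%R.
Proof. by rewrite -{1}(funrposBneg f). Qed.

Let posDneg (f : X -> R) x : (`|f x| = f^\+ x + f^\- x)%R.
Proof. exact/esym/(congr1 (fun g : X -> R => g x) (funrposDneg f)). Qed.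

Let fine_add (p q : X -> R) : measurable_fun setT p -> measurable_fun setT q ->
  (forall x, 0 <= p x)%R -> (forall x, 0 <= q x)%R ->
  E (fun x => (p x)%:E) < +oo -> E (fun x => (q x)%:E) < +oo ->
  E (fun x => (p x + q x)%:E) < +oo /\
  fine (E (fun x => (p x + q x)%:E)) =
    (fine (E (fun x => (p x)%:E)) + fine (E (fun x => (q x)%:E)))%R.
Proof.
move=> mp mq p0 q0 Ep Eq.
have -> : E (fun x => (p x + q x)%:E) = E (fun x => (p x)%:E) + E (fun x => (q x)%:E).
  rewrite -pfunD//; try exact/measurable_EFinP; by move=> x; rewrite lee_fin.
have fp : E (fun x => (p x)%:E) \is a fin_num.
  by rewrite ge0_fin_numE// pfun_ge0// => x; rewrite lee_fin.
have fq : E (fun x => (q x)%:E) \is a fin_num.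
  by rewrite ge0_fin_numE// pfun_ge0// => x; rewrite lee_fin.
by rewrite lte_add_pinfty// fineD.
Qed.

(** Every decomposition into nonnegative functions of finite integral gives the same value, because
    [f^\+ + q = f^\- + p]. Linearity and the composition of averages are read off from suitable
    decompositions. *)
Lemma sE_diff (f p q : X -> R) :
  measurable_fun setT p -> measurable_fun setT q ->
  (forall x, 0 <= p x)%R -> (forall x, 0 <= q x)%R ->
  E (fun x => (p x)%:E) < +oo -> E (fun x => (q x)%:E) < +oo ->
  (forall x, f x = p x - q x)%R ->
  sE f = (fine (E (fun x => (p x)%:E)) - fine (E (fun x => (q x)%:E)))%R.
Proof.
move=> mp mq p0 q0 Ep Eq fpq.
have mf : measurable_fun setT f.
  by rewrite (_ : f = p \- q)%R; [exact: measurable_funB|exact/funext].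
have Efp : E (fun x => (f^\+ x)%R%:E) < +oo.
  apply: le_lt_trans Ep; apply: pfun_le => // x; rewrite lee_fin.
    exact: funrpos_ge0.
  by rewrite /funrpos fpq ge_max p0 andbT gerBl.
have Efn : E (fun x => (f^\- x)%R%:E) < +oo.
  apply: le_lt_trans Eq; apply: pfun_le => // x; rewrite lee_fin.
    exact: funrneg_ge0.
  by rewrite /funrneg fpq opprB ge_max q0 andbT gerBl.
have mfp := measurable_funrpos mf; have mfn := measurable_funrneg mf.
have [_ h1] := fine_add mfp mq (@funrpos_ge0 _ _ f) q0 Efp Eq.
have [_ h2] := fine_add mfn mp (@funrneg_ge0 _ _ f) p0 Efn Ep.
have h : (fun x => (f^\+ x + q x)%:E) = (fun x => (f^\- x + p x)%:E).
  by apply/funext => x; congr EFin; have := fpq x; rewrite posBneg; lra.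
by move: h1; rewrite h h2 /sE => h3; lra.
Qed.

Lemma sint_pos_neg f : sint f ->
  [/\ measurable_fun setT f^\+%R, measurable_fun setT f^\-%R,
      E (fun x => (f^\+ x)%R%:E) < +oo & E (fun x => (f^\- x)%R%:E) < +oo].
Proof.
case=> mf Ef; split.
- exact: measurable_funrpos.
- exact: measurable_funrneg.
- apply: le_lt_trans Ef; apply: pfun_le => // x; rewrite lee_fin.
    exact: funrpos_ge0.
  by rewrite /funrpos ge_max ler_norm normr_ge0.
- apply: le_lt_trans Ef; apply: pfun_le => // x; rewrite lee_fin.
    exact: funrneg_ge0.
  by rewrite /funrneg ge_max -normrN ler_norm normr_ge0.
Qed.

Lemma sintD f g : sint f -> sint g -> sint (fun x => f x + g x)%R.
Proof.
case=> mf Ef [mg Eg]; split; first exact: measurable_funD.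
apply: (@le_lt_trans _ _ (E (fun x => (`|f x| + `|g x|)%:E))).
  by apply: pfun_le => // x; rewrite lee_fin ?ler_normD.
have mn (h : X -> R) : measurable_fun setT h -> measurable_fun setT (fun x => `|h x|)%R.
  by move=> mh; exact: measurableT_comp.
have n0 (h : X -> R) x : (0 <= `|h x|)%R by [].
by have [] := fine_add (mn _ mf) (mn _ mg) (n0 f) (n0 g) Ef Eg.
Qed.

Lemma sintZ c f : sint f -> sint (fun x => c * f x)%R.
Proof.
case=> mf Ef; split; first exact: measurable_funM.
under eq_fun do rewrite normrM EFinM.
rewrite pfunZ//; last first.
  exact/measurable_EFinP/measurableT_comp.
by rewrite lte_mul_pinfty// ge0_fin_numE// pfun_ge0.
Qed.

Lemma sED f g : sint f -> sint g -> sE (fun x => f x + g x)%R = (sE f + sE g)%R.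
Proof.
move=> /sint_pos_neg[mp mq Ep Eq] /sint_pos_neg[mp' mq' Ep' Eq'].
have [h1 e1] := fine_add mp mp' (@funrpos_ge0 _ _ f) (@funrpos_ge0 _ _ g) Ep Ep'.
have [h2 e2] := fine_add mq mq' (@funrneg_ge0 _ _ f) (@funrneg_ge0 _ _ g) Eq Eq'.
rewrite (sE_diff (p := (fun x => f^\+ x + g^\+ x)%R) (q := (fun x => f^\- x + g^\- x)%R))//.
- by rewrite e1 e2 /sE; lra.
- exact: measurable_funD.
- exact: measurable_funD.
- by move=> x; rewrite addr_ge0.
- by move=> x; rewrite addr_ge0.
- by move=> x; rewrite (posBneg f) (posBneg g); lra.
Qed.

Let fineZ (c : R) (p : X -> R) : measurable_fun setT p -> (0 <= c)%R ->
  (forall x, 0 <= p x)%R -> E (fun x => (p x)%:E) < +oo ->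
  E (fun x => (c * p x)%:E) < +oo /\
  fine (E (fun x => (c * p x)%:E)) = (c * fine (E (fun x => (p x)%:E)))%R.
Proof.
move=> mp c0 p0 Ep; under eq_fun do rewrite EFinM.
have p0' x : 0 <= (p x)%:E by rewrite lee_fin.
have fp : E (fun x => (p x)%:E) \is a fin_num by rewrite ge0_fin_numE// pfun_ge0.
rewrite pfunZ//; last exact/measurable_EFinP.
by rewrite lte_mul_pinfty// fineM.
Qed.

Lemma sEZ c f : sint f -> sE (fun x => c * f x)%R = (c * sE f)%R.
Proof.
move=> /sint_pos_neg[mp mq Ep Eq].
have fE := posBneg f.
have [c0|c0] := leP 0%R c.
  have [h1 e1] := fineZ mp c0 (@funrpos_ge0 _ _ f) Ep.
  have [h2 e2] := fineZ mq c0 (@funrneg_ge0 _ _ f) Eq.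
  rewrite (sE_diff (p := (fun x => c * f^\+ x)%R) (q := (fun x => c * f^\- x)%R))//.
  - by rewrite e1 e2 /sE mulrBr.
  - exact: measurable_funM.
  - exact: measurable_funM.
  - by move=> x; rewrite mulr_ge0.
  - by move=> x; rewrite mulr_ge0.
  - by move=> x; rewrite fE mulrBr.
have {}c0 : (0 <= - c)%R by rewrite oppr_ge0 ltW.
have [h1 e1] := fineZ mp c0 (@funrpos_ge0 _ _ f) Ep.
have [h2 e2] := fineZ mq c0 (@funrneg_ge0 _ _ f) Eq.
rewrite (sE_diff (p := (fun x => - c * f^\- x)%R) (q := (fun x => - c * f^\+ x)%R))//.
- by rewrite e1 e2 /sE; lra.
- exact: measurable_funM.
- exact: measurable_funM.
- by move=> x; rewrite mulr_ge0.
- by move=> x; rewrite mulr_ge0.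
- by move=> x; rewrite fE; lra.
Qed.

Lemma cmeasD f g : cmeas f -> cmeas g -> cmeas (fun x => f x + g x)%R.
Proof.
case=> rf if_ [rg ig]; split.
  rewrite (_ : _ \o _ = (fun x => complex.Re (f x) + complex.Re (g x)))%R.
    exact: measurable_funD.
  by apply/funext => x; exact: ReD.
rewrite (_ : _ \o _ = (fun x => complex.Im (f x) + complex.Im (g x)))%R.
  exact: measurable_funD.
by apply/funext => x; exact: ImD.
Qed.

Lemma cmeasZ c f : cmeas f -> cmeas (fun x => c * f x)%R.
Proof.
case=> rf if_; split.
  rewrite (_ : _ \o _ = (fun x => complex.Re c * complex.Re (f x) -
    complex.Im c * complex.Im (f x)))%R.
    by apply: measurable_funB; exact: measurable_funM.
  by apply/funext => x; exact: ReM.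
rewrite (_ : _ \o _ = (fun x => complex.Re c * complex.Im (f x) +
  complex.Im c * complex.Re (f x)))%R.
  by apply: measurable_funD; exact: measurable_funM.
by apply/funext => x; exact: ImM.
Qed.

Lemma cmeas_sum (I : Type) (s : seq I) (f : I -> X -> R[i]) :
  (forall i, cmeas (f i)) -> cmeas (fun x => \sum_(i <- s) f i x)%R.
Proof.
move=> mf; elim: s => [|i s IH].
  by under eq_fun do rewrite big_nil; split; exact: measurable_cst.
by under eq_fun do rewrite big_cons; exact: cmeasD.
Qed.

Lemma cintD f g : cint f -> cint g -> cint (fun x => f x + g x)%R.
Proof.
case=> rf if_ [rg ig]; split.
  rewrite (_ : _ \o _ = (fun x => complex.Re (f x) + complex.Re (g x)))%R.
    exact: sintD.
  by apply/funext => x; exact: ReD.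
rewrite (_ : _ \o _ = (fun x => complex.Im (f x) + complex.Im (g x)))%R.
  exact: sintD.
by apply/funext => x; exact: ImD.
Qed.

Lemma cED f g : cint f -> cint g -> cE (fun x => f x + g x)%R = (cE f + cE g)%R.
Proof.
case=> rf if_ [rg ig]; rewrite /cE.
rewrite (_ : _ \o _ = (fun x => complex.Re (f x) + complex.Re (g x)))%R; last first.
  by apply/funext => x; exact: ReD.
rewrite sED//.
rewrite (_ : _ \o _ = (fun x => complex.Im (f x) + complex.Im (g x)))%R; last first.
  by apply/funext => x; exact: ImD.
by rewrite sED.
Qed.

Lemma cintZ c f : cint f -> cint (fun x => c * f x)%R.
Proof.
case=> rf if_; split.
  rewrite (_ : _ \o _ = (fun x => complex.Re c * complex.Re (f x) +
    - complex.Im c * complex.Im (f x)))%R.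
    by apply: sintD; exact: sintZ.
  by apply/funext => x /=; rewrite ReM mulNr.
rewrite (_ : _ \o _ = (fun x => complex.Re c * complex.Im (f x) +
  complex.Im c * complex.Re (f x)))%R.
  by apply: sintD; exact: sintZ.
by apply/funext => x; exact: ImM.
Qed.

Lemma cEZ c f : cint f -> cE (fun x => c * f x)%R = (c * cE f)%R.
Proof.
case=> rf if_; rewrite /cE.
rewrite (_ : _ \o _ = (fun x => complex.Re c * complex.Re (f x) +
  - complex.Im c * complex.Im (f x)))%R; last first.
  by apply/funext => x /=; rewrite ReM mulNr.
rewrite sED; [|exact: sintZ|exact: sintZ].
rewrite (_ : _ \o _ = (fun x => complex.Re c * complex.Im (f x) +
  complex.Im c * complex.Re (f x)))%R; last first.
  by apply/funext => x; exact: ImM.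
rewrite sED; [|exact: sintZ|exact: sintZ].
rewrite !sEZ//; case: c => a b /=; apply/eqP; rewrite eq_complex /=.
by rewrite mulNr !eqxx.
Qed.

Lemma cint0 : cint (fun=> 0%R).
Proof.
have h : sint (fun=> 0%R).
  split; first exact: measurable_cst.
  rewrite (_ : (fun x : X => _) = (fun x : X => 0%:E * cst 0 x)); last first.
    by apply/funext => x; rewrite normr0 mul0e.
  by rewrite pfunZ// mul0e ltry.
by split.
Qed.

Lemma cint_sum (I : Type) (s : seq I) (f : I -> X -> R[i]) :
  (forall i, cint (f i)) -> cint (fun x => \sum_(i <- s) f i x)%R.
Proof.
move=> mf; elim: s => [|i s IH].
  by under eq_fun do rewrite big_nil; exact: cint0.
by under eq_fun do rewrite big_cons; exact: cintD.
Qed.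

Lemma cE_sum (I : Type) (s : seq I) (f : I -> X -> R[i]) :
  (forall i, cint (f i)) ->
  cE (fun x => \sum_(i <- s) f i x)%R = (\sum_(i <- s) cE (f i))%R.
Proof.
move=> mf; elim: s => [|i s IH].
  rewrite big_nil; under eq_fun do rewrite big_nil.
  rewrite (_ : (fun _ => 0%R) = (fun x : X => 0 * (cst 0 : X -> R[i]) x)%R).
    by rewrite cEZ ?mul0r//; exact: cint0.
  by apply/funext => x; rewrite mul0r.
rewrite big_cons; under eq_fun do rewrite big_cons.
by rewrite cED ?IH//; exact: cint_sum.
Qed.

Section normalized.
Hypothesis E1 : E (fun=> 1) = 1.

Lemma pfun_cst (c : R) : (0 <= c)%R -> E (fun=> c%:E) = c%:E.
Proof.
move=> c0; under eq_fun do rewrite -[c%:E]mule1.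
rewrite (pfunZ pE (f := fun=> 1))// ?E1 ?mule1//; exact: measurable_cst.
Qed.

(** The integrated form of [0 <= (|f| - t)^2]. With [t = 1] it makes a square-integrable function
    integrable; with [t] the integral of [|f|] it yields Jensen's inequality. *)
Let young (f : X -> R) (t : R) : measurable_fun setT f -> (0 <= t)%R ->
  (2 * t)%:E * E (fun x => `|f x|%:E) <= E (fun x => (f x ^+ 2)%:E) + (t ^+ 2)%:E.
Proof.
move=> mf t0; rewrite -pfunZ ?mulr_ge0//; last first.
  exact/measurable_EFinP/measurableT_comp.
have sq0 x : 0 <= (f x ^+ 2)%:E by rewrite lee_fin sqr_ge0.
have tt0 : 0 <= (t ^+ 2)%:E by rewrite lee_fin sqr_ge0.
have msq : measurable_fun setT (fun x => (f x ^+ 2)%:E).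
  exact/measurable_EFinP/measurable_funX.
rewrite -(pfun_cst (sqr_ge0 t)) -pfunD//.
apply: pfun_le => // x; first by rewrite mule_ge0// lee_fin ?mulr_ge0.
rewrite -EFinM -EFinD lee_fin -real_normK ?num_real//.
by have := sqr_ge0 (`|f x| - t)%R; nra.
Qed.

Lemma sint_sq (f : X -> R) : measurable_fun setT f -> E (fun x => (f x ^+ 2)%:E) < +oo ->
  sint f.
Proof.
move=> mf Ef; split => //.
have := young mf ler01; rewrite mulr1 expr1n => h.
have : (2%:E : \bar R) * E (fun x => `|f x|%:E) < +oo.
  by apply: le_lt_trans h _; rewrite lte_add_pinfty// ltry.
rewrite !ltey; apply: contra => /eqP ->.
by rewrite gt0_muley// lte_fin.
Qed.

Lemma sE_norm (f : X -> R) : sint f -> (`|sE f| <= fine (E (fun x => `|f x|%:E)))%R.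
Proof.
move=> sf; have [mp mq Ep Eq] := sint_pos_neg sf.
have [_ e] := fine_add mp mq (@funrpos_ge0 _ _ f) (@funrneg_ge0 _ _ f) Ep Eq.
have -> : E (fun x => `|f x|%:E) = E (fun x => (f^\+ x + f^\- x)%:E).
  by congr E; apply/funext => x; rewrite posDneg.
rewrite e /sE.
have p0 : (0 <= fine (E (fun x => (f^\+ x)%R%:E)))%R.
  by apply: fine_ge0; apply: pfun_ge0 => // x; rewrite lee_fin.
have q0 : (0 <= fine (E (fun x => (f^\- x)%R%:E)))%R.
  by apply: fine_ge0; apply: pfun_ge0 => // x; rewrite lee_fin.
by rewrite ler_norml; apply/andP; split; lra.
Qed.

(** An infinite right-hand side makes the bound trivial, and a finite one makes [f] integrable, so
    measurability of [f] is enough. *)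
Lemma sE_sq (f : X -> R) : measurable_fun setT f -> (sE f ^+ 2)%:E <= E (fun x => (f x ^+ 2)%:E).
Proof.
move=> mf; have sq0 x : 0 <= (f x ^+ 2)%:E by rewrite lee_fin sqr_ge0.
have [Ef|] := ltP (E (fun x => (f x ^+ 2)%:E)) +oo; last first.
  by rewrite leye_eq => /eqP ->; rewrite leey.
have sf := sint_sq mf Ef; have := sE_norm sf.
set t := fine _ => ht; have t0 : (0 <= t)%R.
  by apply: fine_ge0; apply: pfun_ge0.
have fE : E (fun x => `|f x|%:E) \is a fin_num.
  by rewrite ge0_fin_numE ?pfun_ge0//; case: sf.
have fE2 : E (fun x => (f x ^+ 2)%:E) \is a fin_num by rewrite ge0_fin_numE ?pfun_ge0.
have := young mf t0; rewrite -(fineK fE) -/t -(fineK fE2) -EFinM -EFinD !lee_fin => h.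
have : (sE f ^+ 2 <= t ^+ 2)%R by rewrite -real_normK ?num_real// lerXn2r// nnegrE.
nra.
Qed.

Lemma cE_nsq (f : X -> R[i]) : cmeas f -> (nsq (cE f))%:E <= E (fun x => (nsq (f x))%:E).
Proof.
case=> rf if_; rewrite /nsq /= EFinD.
apply: le_trans (leeD (sE_sq rf) (sE_sq if_)) _.
rewrite -pfunD//; try exact/measurable_EFinP/measurable_funX.
all: by move=> x; rewrite lee_fin sqr_ge0.
Qed.

Lemma cint_nsq (f : X -> R[i]) : cmeas f -> E (fun x => (nsq (f x))%:E) < +oo -> cint f.
Proof.
case=> rf if_ Ef; split; apply: sint_sq => //; apply: le_lt_trans Ef;
  apply: pfun_le => // x; rewrite lee_fin ?sqr_ge0// /nsq.
  by rewrite lerDl sqr_ge0.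
by rewrite lerDr sqr_ge0.
Qed.

Lemma cE_cst c : cE (fun=> c) = c.
Proof.
have h (a : R) : sE (fun=> a) = a.
  rewrite (_ : (fun=> a) = (fun=> a * 1)%R :> (X -> R)); last first.
    by apply/funext => x; rewrite mulr1.
  have s1 : sint (fun=> 1%R).
    split; first exact: measurable_cst.
    by rewrite normr1 E1 ltry.
  rewrite sEZ// (sE_diff (p := fun=> 1%R) (q := fun=> 0%R))//.
  - by rewrite E1 pfun_cst//= subr0 mulr1.
  - by rewrite E1 ltry.
  - by rewrite pfun_cst// ltry.
  - by move=> x; rewrite subr0.
by rewrite /cE !h; case: c.
Qed.

End normalized.
End positive_functional.

(** * Square-integrable cochains and averaging kernels *)

Definition wE {d : measure_display} {T : measurableType d} {R : realType}
    (mu : {sigma_finite_measure set T -> \bar R}) w k z :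
    (coord_space nat T -> \bar R) -> \bar R := fun F => witer mu w k F z.

Section witer_functional.
Context {d : measure_display} {T : measurableType d} {R : realType}.
Variable mu : {sigma_finite_measure set T -> \bar R}.
Local Open Scope ereal_scope.
Variables (w : nat -> T -> \bar R).
Hypothesis mw : forall i, measurable_fun setT (w i).
Hypothesis w0 : forall i t, 0 <= w i t.

Lemma witer_positive_functional k z :
  positive_functional (wE mu w k z).
Proof.
rewrite /wE; split.
- by move=> F F0; exact: witer_ge0.
- move=> F G F0 FG; apply: le_witer => // y; exact: le_trans (F0 y) (FG y).
- by move=> F G mF mG F0 G0; exact: witerD.
- by move=> F c mF F0 c0; rewrite witerZ.
Qed.

Lemma cE_bump k i (f : coord_space nat T -> R[i]) z : (i <= k)%N ->
  \int[mu]_t w i t = 1 -> cmeas f ->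
  cE (wE mu w k.+1 z) (fun y => f (y \o bump i)) =
  cE (wE mu (w \o bump i) k (z \o bump i)) f.
Proof.
move=> ik wi1 [rf if_]; rewrite /cE.
have h (g : coord_space nat T -> R) : measurable_fun setT g ->
    sE (wE mu w k.+1 z) (fun y => g (y \o bump i)) =
    sE (wE mu (w \o bump i) k (z \o bump i)) g.
  move=> mg; rewrite /sE /wE; congr (fine _ - fine _)%R.
  - rewrite -(@witer_bump _ _ _ mu w k i (fun y => (g^\+ y)%R%:E) z ik)//.
      exact/measurable_EFinP/measurable_funrpos.
    by move=> y; rewrite lee_fin.
  - rewrite -(@witer_bump _ _ _ mu w k i (fun y => (g^\- y)%R%:E) z ik)//.
      exact/measurable_EFinP/measurable_funrneg.
    by move=> y; rewrite lee_fin.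
by congr (_ +i* _)%C; exact: h.
Qed.

End witer_functional.

Lemma eq_cE_witer {d : measure_display} {T : measurableType d} {R : realType}
    (mu : {sigma_finite_measure set T -> \bar R}) w w' k z
    (f : coord_space nat T -> R[i]) :
  (forall i t, 0 <= w i t)%E -> (forall i t, 0 <= w' i t)%E ->
  (forall i t, (i < k)%N -> w i t = w' i t) ->
  cE (wE mu w k z) f = cE (wE mu w' k z) f.
Proof.
move=> w0 w'0 ww'; rewrite /cE /sE /wE.
by congr ((fine _ - fine _) +i* (fine _ - fine _))%C; apply: eq_witer => // y;
  rewrite lee_fin.
Qed.

(** The properties of a group on which the cochain estimates rest. The bound in [cs_ball] is uniform
    in the centre; for groups this comes from left invariance. *)
Record coarse_space d (T : measurableType d) (R : realType) (dist : T -> T -> R)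
    (mu : {sigma_finite_measure set T -> \bar R}) : Prop := {
  cs_meas : measurable_fun setT (fun p : T * T => dist p.1 p.2);
  cs_sym : forall x y, dist x y = dist y x;
  cs_tri : forall x y z, dist x z <= dist x y + dist y z;
  cs_ball : forall r, exists C : R, forall x,
    (mu [set y | (dist x y <= r)%R] <= C%:E)%E }.

(** A coarse map blurred into transition densities. [ck_int1] makes averaging commute with the
    differential, [ck_int2] bounds it in the seminorms, [ck_le] gives convergence at every point,
    and [ck_ctl] limits the spread of the supports. One constant [C] serves both bounds. *)
Record coarse_kernel d d' (S : measurableType d) (T : measurableType d')
    (R : realType) (dS : S -> S -> R) (nu : {sigma_finite_measure set S -> \bar R})
    (dT : T -> T -> R) (mu : {sigma_finite_measure set T -> \bar R})
    (K : S -> T -> \bar R) (C : R) : Prop := {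
  ck_meas : measurable_fun setT (fun p : S * T => K p.1 p.2);
  ck_ge0 : forall s t, (0 <= K s t)%E;
  ck_le : forall s t, (K s t <= C%:E)%E;
  ck_int1 : forall s, (\int[mu]_t K s t = 1)%E;
  ck_int2 : forall t, (\int[nu]_s K s t <= C%:E)%E;
  ck_ctl : forall r, exists r', forall s s' t t', K s t != 0%E -> K s' t' != 0%E ->
    dS s s' <= r -> dT t t' <= r' }.

Section energy.
Context {d : measure_display} {T : measurableType d} {R : realType}.
Variables (dist : T -> T -> R) (mu : {sigma_finite_measure set T -> \bar R}) (e : T).
Hypothesis csT : coarse_space dist mu.
Local Open Scope ereal_scope.

Definition energy r n (f : (nat -> T) -> R[i]) : \bar R :=
  witer mu (fun _ _ => 1) n.+1 (cut dist r n (fun x => (nsq (f x))%:E)) (fun=> e).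

(* Functions of all coordinates represent n-cochains through their values on
   the coordinates 0, .., n. *)
Definition l2c n (f : (nat -> T) -> R[i]) : Prop :=
  cmeas (f : coord_space nat T -> R[i]) /\
  forall r, (0 < r)%R -> energy r n f < +oo.

Definition ncob n (f : (nat -> T) -> R[i]) (x : nat -> T) : R[i] :=
  (\sum_(i < n.+2) (-1) ^+ i * f (x \o bump i))%R.

Let m1 : forall i : nat, measurable_fun setT (fun _ : T => 1 : \bar R).
Proof. by move=> _; exact: measurable_cst. Qed.

Lemma measurable_nsq d' (X : measurableType d') (f : X -> R[i]) :
  cmeas f -> measurable_fun setT (fun x => (nsq (f x))%:E).
Proof.
case=> rf if_; apply/measurable_EFinP.
by apply: measurable_funD; exact: measurable_funX.
Qed.

Let mcut r n (f : (nat -> T) -> R[i]) : cmeas (f : coord_space nat T -> R[i]) ->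
  measurable_fun setT (cut dist r n (fun x => (nsq (f x))%:E)
    : coord_space nat T -> \bar R).
Proof. by move=> mf; apply: (measurable_cut (cs_meas csT)); exact: measurable_nsq. Qed.

Let cut0 r n (f : (nat -> T) -> R[i]) x : 0 <= cut dist r n (fun x => (nsq (f x))%:E) x.
Proof. by apply: cut_ge0 => y; rewrite lee_fin nsq_ge0. Qed.

Lemma energy_ge0 r n f : 0 <= energy r n f.
Proof. exact: witer_ge0. Qed.

Lemma energyD r n f g : cmeas (f : coord_space nat T -> R[i]) ->
  cmeas (g : coord_space nat T -> R[i]) ->
  energy r n (fun x => f x + g x)%R <= 2%:E * (energy r n f + energy r n g).
Proof.
move=> mf mg; have s0 h x : 0 <= cut dist r n (fun x => (nsq (h x))%:E) x by [].
rewrite /energy -witerD//; try exact: mcut.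
rewrite -witerZ//.
- apply: le_witer => // y; first by rewrite mule_ge0// adde_ge0.
  move=> _ _; rewrite /cut; case: asboolP => _; last by rewrite add0e mule0.
  by rewrite -EFinD -EFinM lee_fin nsqD_le.
- by apply: emeasurable_funD; exact: mcut.
- by move=> y; rewrite adde_ge0.
Qed.

Lemma energyZ r n c f : cmeas (f : coord_space nat T -> R[i]) ->
  energy r n (fun x => c * f x)%R = (nsq c)%:E * energy r n f.
Proof.
move=> mf; rewrite /energy -witerZ ?lee_fin ?nsq_ge0//; last exact: mcut.
apply: eq_witer_fun => x; rewrite /cut; case: asboolP; rewrite ?mule0//.
by rewrite nsqM EFinM.
Qed.

Lemma l2cD n f g : l2c n f -> l2c n g -> l2c n (fun x => f x + g x)%R.
Proof.
case=> mf ef [mg eg]; split; first exact: cmeasD.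
move=> r r0; apply: le_lt_trans (energyD _ _ mf mg) _.
by rewrite lte_mul_pinfty// lte_add_pinfty// ?ef ?eg.
Qed.

Lemma l2cZ n c f : l2c n f -> l2c n (fun x => c * f x)%R.
Proof.
case=> mf ef; split; first exact: cmeasZ.
move=> r r0; rewrite energyZ// lte_mul_pinfty// ?ef ?lee_fin ?nsq_ge0//.
Qed.

Lemma l2c_sum n k (f : 'I_k -> (nat -> T) -> R[i]) : (forall i, l2c n (f i)) ->
  l2c n (fun x => \sum_(i < k) f i x)%R.
Proof.
elim: k f => [|k IH] f lf.
  under eq_fun do rewrite big_ord0.
  split; first by split; exact: measurable_cst.
  move=> r _; rewrite /energy (_ : cut _ _ _ _ = fun=> 0).
    rewrite (_ : (fun=> 0) = (fun x : coord_space nat T => 0 * cst 0 x)).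
      by rewrite witerZ// mul0e ltry.
    by apply/funext => x; rewrite mul0e.
  by apply/funext => x; rewrite /cut nsq0 if_same.
under eq_fun do rewrite big_ord_recl.
by apply: l2cD => //; apply: IH => i; exact: lf.
Qed.

Lemma energy_bump r n i C f : (i <= n.+1)%N ->
  cmeas (f : coord_space nat T -> R[i]) ->
  (forall x, mu [set y | (dist x y <= r)%R] <= C%:E) ->
  energy r n.+1 (fun x => f (x \o bump i)) <= C%:E * energy r n f.
Proof.
move=> ik mf bC.
apply: (witer_face (cs_meas csT) (F := fun x => (nsq (f x))%:E) _ ik) => //.
  exact: measurable_nsq.
by move=> y; rewrite lee_fin nsq_ge0.
Qed.

Lemma cmeas_bump i (f : (nat -> T) -> R[i]) :
  cmeas (f : coord_space nat T -> R[i]) ->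
  cmeas (fun x : coord_space nat T => f (x \o bump i)).
Proof.
by case=> rf if_; split; [exact: (measurableT_comp rf (measurable_bump i))
                         |exact: (measurableT_comp if_ (measurable_bump i))].
Qed.

Lemma l2c_ncob n f : l2c n f -> l2c n.+1 (ncob n f).
Proof.
move=> lf; apply: l2c_sum => i; apply: l2cZ.
case: lf => mf ef; split; first exact: cmeas_bump.
move=> r r0; have [C bC] := cs_ball csT r.
have C0 : 0 <= C%:E by exact: le_trans (measure_ge0 _ _) (bC point).
apply: le_lt_trans (energy_bump _ mf bC) _; first by rewrite -ltnS.
by rewrite lte_mul_pinfty// ef.
Qed.

(** Every single tuple lies in some controlled domain, so finiteness of all seminorms can be used at
    each point. *)
Lemma near_tuple_ex n x : exists2 r, (0 < r)%R & near_tuple dist r n x.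
Proof.
exists (1 + \sum_(i < n.+1) \sum_(j < n.+1) `|dist (x i) (x j)|)%R.
  by rewrite ltr_wpDr// sumr_ge0// => i _; rewrite sumr_ge0.
move=> i j ni nj; rewrite -ltnS in ni; rewrite -ltnS in nj.
apply: ler_wpDl => //; rewrite (bigD1 (Ordinal ni))//=.
apply: ler_wpDr; first by rewrite sumr_ge0// => ? _; rewrite sumr_ge0.
rewrite (bigD1 (Ordinal nj))//=.
by apply: ler_wpDr; [rewrite sumr_ge0|rewrite ler_norm].
Qed.

(** Where [B] is finite [f] is 0, and where [B] is infinite so is [eps * B]. Hence
    [nsq f <= eps * B] everywhere, for every [eps > 0], and the energy is at most [eps] times a
    finite number. *)
Lemma null_of_finite_majorant r n (f : (nat -> T) -> R[i]) (B : (nat -> T) -> \bar R) :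
  measurable_fun setT (B : coord_space nat T -> \bar R) -> (forall x, 0 <= B x) ->
  (forall x, B x < +oo -> f x = 0%R) ->
  witer mu (fun _ _ => 1) n.+1 (cut dist r n B) (fun=> e) < +oo ->
  energy r n f = 0.
Proof.
move=> mB B0 fB; set I := witer _ _ _ _ _ => I1.
have I0 : 0 <= I by apply: witer_ge0 => // y; exact: cut_ge0.
have h (eps : R) : (0 < eps)%R -> energy r n f <= eps%:E * I.
  move=> eps0; rewrite /I -witerZ ?lee_fin ?(ltW eps0)//; last 2 first.
  - exact: (measurable_cut (cs_meas csT)).
  - by move=> y; exact: cut_ge0.
  rewrite /energy; apply: le_witer => // y.
    by rewrite mule_ge0 ?lee_fin ?(ltW eps0)// cut_ge0.
  move=> _ _; rewrite /cut; case: asboolP => _; last by rewrite mule0.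
  have [By|] := ltP (B y) +oo.
    by rewrite fB// nsq0 mule_ge0// lee_fin ltW.
  by rewrite leye_eq => /eqP ->; rewrite gt0_muley ?leey// lte_fin.
apply/eqP; rewrite eq_le energy_ge0 andbT.
apply/lee_addgt0Pr => eps eps0; rewrite add0e.
have fI : I \is a fin_num by rewrite ge0_fin_numE.
(* The added 1 avoids a division by 0. *)
have I1' : (0 < fine I + 1)%R by rewrite ltr_wpDl// fine_ge0.
apply: le_trans (h (eps / (fine I + 1))%R _) _; first by rewrite divr_gt0.
rewrite -(fineK fI) -EFinM lee_fin -mulrA ler_piMr ?(ltW eps0)//.
by rewrite mulrC ler_pdivrMr// mul1r lerDl.
Qed.

End energy.

(** * Averaging against a kernel *)

Section kernel_average.
Context {d d' : measure_display} {S : measurableType d} {T : measurableType d'}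
  {R : realType}.
Variables (dS : S -> S -> R) (nu : {sigma_finite_measure set S -> \bar R}) (eS : S).
Variables (dT : T -> T -> R) (mu : {sigma_finite_measure set T -> \bar R}) (eT : T).
Variables (K : S -> T -> \bar R) (C : R).
Hypothesis csS : coarse_space dS nu.
Hypothesis csT : coarse_space dT mu.
Hypothesis ckK : coarse_kernel dS nu dT mu K C.
Local Open Scope ereal_scope.

(** Here [n] counts variables, so an n-cochain is averaged with [n.+1]; the remaining coordinates of
    the integration point stay at the base point [eT]. *)
Definition kE (K : S -> T -> \bar R) n (x : nat -> S) :=
  wE mu (fun i => K (x i)) n (fun=> eT).

Definition avg (K : S -> T -> \bar R) n (f : (nat -> T) -> R[i]) (x : nat -> S) :
  R[i] := cE (kE K n.+1 x) f.

Let K0 := ck_ge0 ckK.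
Let mK := ck_meas ckK.

Let mKx (x : nat -> S) i : measurable_fun setT (K (x i)).
Proof. exact: (measurable_kernel_coord mK i x). Qed.

Lemma ck_bound_ge0 : 0 <= C%:E.
Proof. exact: le_trans (K0 point point) (ck_le ckK _ _). Qed.

Lemma kE_positive n x : positive_functional (kE K n x).
Proof. by apply: witer_positive_functional => //; exact: mKx. Qed.

Lemma kE1 n x : kE K n x (fun=> 1) = 1.
Proof.
by apply: witer_cst => // i _; exact: (ck_int1 ckK).
Qed.

Lemma kE_ge0 n x F : (forall y, 0 <= F y) -> 0 <= kE K n x F.
Proof. exact: pfun_ge0 (kE_positive n x) _. Qed.

Lemma measurable_kE n (F : coord_space nat S -> coord_space nat T -> \bar R) :
  measurable_fun setT (fun p : coord_space nat S * coord_space nat T => F p.1 p.2) ->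
  (forall x y, 0 <= F x y) ->
  measurable_fun setT (fun x : coord_space nat S => kE K n x (F x)).
Proof.
move=> mF F0; exact: (measurableT_comp (measurable_witer_kernel mu mK K0 n mF F0)
  (@pair2_measurable _ _ (coord_space nat S) (coord_space nat T) (fun=> eT))).
Qed.

Lemma cmeas_cE_kE n (f : coord_space nat S -> coord_space nat T -> R[i]) :
  cmeas (fun p : coord_space nat S * coord_space nat T => f p.1 p.2) ->
  cmeas (fun x : coord_space nat S => cE (kE K n x) (f x)).
Proof.
case=> rf if_.
have h (g : coord_space nat S -> coord_space nat T -> R) :
    measurable_fun setT (fun p : coord_space nat S * coord_space nat T => g p.1 p.2) ->
    measurable_fun setT (fun x : coord_space nat S => sE (kE K n x) (g x)).
  move=> mg; apply: measurable_funB.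
    apply: (measurableT_comp (fine_measurable measurableT)) => //.
    apply: (@measurable_kE n (fun x y => ((g x)^\+ y)%R%:E)) => [|x y].
      apply/measurable_EFinP.
      exact: (measurable_funrpos mg).
    by rewrite lee_fin.
  apply: (measurableT_comp (fine_measurable measurableT)) => //.
  apply: (@measurable_kE n (fun x y => ((g x)^\- y)%R%:E)) => [|x y].
    apply/measurable_EFinP.
    exact: (measurable_funrneg mg).
  by rewrite lee_fin.
by split; [exact: (h (fun x y => complex.Re (f x y)))
          |exact: (h (fun x y => complex.Im (f x y)))].
Qed.

Lemma cmeas_avg n (f : (nat -> T) -> R[i]) : cmeas (f : coord_space nat T -> R[i]) ->
  cmeas (avg K n f : coord_space nat S -> R[i]).
Proof.
case=> rf if_; apply: (@cmeas_cE_kE n.+1 (fun=> f)); split.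
  exact: (measurableT_comp rf measurable_snd).
exact: (measurableT_comp if_ measurable_snd).
Qed.

Lemma integral_kE_snd n (v : nat -> S -> \bar R) (F : (nat -> T) -> \bar R) y :
  (forall i, measurable_fun setT (v i)) -> (forall i s, 0 <= v i s) ->
  measurable_fun setT (F : coord_space nat T -> \bar R) -> (forall z, 0 <= F z) ->
  witer nu v n (fun x => kE K n x F) y =
  witer mu (fun i t => \int[nu]_s (v i s * K s t)) n F (fun=> eT).
Proof.
move=> mv v0 mF F0; rewrite -(piter_snd nu mu mv v0 mK K0 n y (fun=> eT) mF F0).
rewrite -(witer_witer nu mu mv v0 mK K0 n (F := fun _ => F))//.
exact: (measurableT_comp mF measurable_snd).
Qed.

(** On the supports of the weights [ck_ctl] bounds the diameter of the integration point in terms of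
    that of [x], so cutting off the integrand loses nothing. The witness is enlarged to [|r'| + 1]
    for positivity. *)
Lemma kE_supp_le r n : exists2 r', (0 < r')%R & forall (x : nat -> S) F,
  (forall y, 0 <= F y) -> near_tuple dS r n x ->
  kE K n.+1 x F <= kE K n.+1 x (cut dT r' n F).
Proof.
have [r' hr'] := ck_ctl ckK r; exists (`|r'| + 1)%R; first by rewrite ltr_wpDl.
move=> x F F0 nx; apply: le_witer => // y; first exact: cut_ge0.
move=> Ky _; rewrite /cut asboolT// => i j ni nj.
apply: (@le_trans _ _ r').
  by apply: (hr' (x i) (x j)); [exact: Ky|exact: Ky|exact: nx].
by apply: ler_wpDr => //; rewrite ler_norm.
Qed.

Lemma kE_le_energy n x (F : (nat -> T) -> \bar R) :
  measurable_fun setT (F : coord_space nat T -> \bar R) -> (forall z, 0 <= F z) ->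
  kE K n x F <= (C ^+ n)%:E * witer mu (fun _ _ => 1) n F (fun=> eT).
Proof.
move=> mF F0; have := ck_bound_ge0; rewrite lee_fin => C0.
rewrite -witer_cst_weight//; apply: le_witer => // i t _; exact: (ck_le ckK).
Qed.

(** After Jensen, the integral over [x_i] acts only on the weight [K (x_i) (z_i)] and costs at most
    [C]; hence the power [n.+1], one factor for each vertex. *)
Lemma energy_avg n r : exists r' C' : R, [/\ (0 < r')%R, (0 <= C')%R &
  forall f, cmeas (f : coord_space nat T -> R[i]) ->
    energy dS nu eS r n (avg K n f) <= C'%:E * energy dT mu eT r' n f].
Proof.
have [r' r'0 hr'] := kE_supp_le r n.
have := ck_bound_ge0; rewrite lee_fin => C0.
exists r', (C ^+ n.+1)%R; split => //; first by rewrite exprn_ge0.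
move=> f mf; have nf0 z : 0 <= (nsq (f z))%:E by rewrite lee_fin nsq_ge0.
have mcf : measurable_fun setT (cut dT r' n (fun z => (nsq (f z))%:E)
    : coord_space nat T -> \bar R).
  by apply: (measurable_cut (cs_meas csT)); exact: measurable_nsq.
apply: (@le_trans _ _ (witer nu (fun _ _ => 1) n.+1
    (fun x => kE K n.+1 x (cut dT r' n (fun z => (nsq (f z))%:E))) (fun=> eS))).
  apply: le_witer => //.
  - by move=> x; apply: cut_ge0 => y; rewrite lee_fin nsq_ge0.
  - by move=> x; apply: kE_ge0 => y; exact: cut_ge0.
  move=> x _ _; rewrite {1}/cut; case: asboolP => nx; last first.
    by apply: kE_ge0 => y; exact: cut_ge0.
  apply: le_trans (hr' x _ nf0 nx).
  exact: (cE_nsq (kE_positive n.+1 x) (kE1 n.+1 x)).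
rewrite integral_kE_snd//; last by move=> z; exact: cut_ge0.
rewrite -witer_cst_weight//; last by move=> z; exact: cut_ge0.
apply: le_witer => //.
- by move=> i t; apply: integral_ge0 => s _; rewrite mul1e.
- by move=> z; exact: cut_ge0.
- by move=> z; exact: cut_ge0.
move=> i t _; under eq_integral do rewrite mul1e.
exact: (ck_int2 ckK).
Qed.

(** Finite at every [x], not just almost every [x]: all coordinates are integrated, with density at
    most a power of [C], over a controlled domain, so a seminorm of [f] bounds the integral. *)
Lemma kE_nsq_lty n f x : l2c dT mu eT n f ->
  kE K n.+1 x (fun z => (nsq (f z))%:E) < +oo.
Proof.
case=> mf ef; have [r r0 nx] := near_tuple_ex dS n x.
have [r' r'0 hr'] := kE_supp_le r n.
have nf0 z : 0 <= (nsq (f z))%:E by rewrite lee_fin nsq_ge0.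
apply: le_lt_trans (hr' x _ nf0 nx) _.
apply: le_lt_trans (kE_le_energy _ _ _ _) _.
- by apply: (measurable_cut (cs_meas csT)); exact: measurable_nsq.
- by move=> z; exact: cut_ge0.
have := ck_bound_ge0; rewrite lee_fin => C0.
by rewrite lte_mul_pinfty// ?lee_fin ?exprn_ge0//; exact: ef.
Qed.

Lemma cint_kE n f x : l2c dT mu eT n f -> cint (kE K n.+1 x) f.
Proof.
move=> lf; apply: (cint_nsq (kE_positive n.+1 x) (kE1 n.+1 x)); first by case: lf.
exact: kE_nsq_lty.
Qed.

Lemma l2c_avg n f : l2c dT mu eT n f -> l2c dS nu eS n (avg K n f).
Proof.
case=> mf ef; split; first exact: cmeas_avg.
move=> r r0; have [r' [C' [r'0 C'0 h]]] := energy_avg n r.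
by apply: le_lt_trans (h _ mf) _; rewrite lte_mul_pinfty// ef.
Qed.

Lemma avgD n f g x : l2c dT mu eT n f -> l2c dT mu eT n g ->
  avg K n (fun z => f z + g z)%R x = (avg K n f x + avg K n g x)%R.
Proof.
by move=> lf lg; rewrite /avg (cED (kE_positive _ _))//; exact: cint_kE.
Qed.

Lemma avgZ n c f x : l2c dT mu eT n f ->
  avg K n (fun z => c * f z)%R x = (c * avg K n f x)%R.
Proof.
by move=> lf; rewrite /avg (cEZ (kE_positive _ _))//; exact: cint_kE.
Qed.

Lemma avg_ext n f (x y : nat -> S) : (forall i, (i <= n)%N -> x i = y i) ->
  avg K n f x = avg K n f y.
Proof.
by move=> xy; apply: eq_cE_witer => // i t; rewrite ltnS => ni; rewrite xy.
Qed.

Lemma avg_bump n i f x : (i <= n.+1)%N -> cmeas (f : coord_space nat T -> R[i]) ->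
  cE (kE K n.+2 x) (fun z => f (z \o bump i)) = avg K n f (x \o bump i).
Proof.
move=> ik mf.
by rewrite (@cE_bump _ _ _ mu (fun i => K (x i)) _ _ n.+1 i)//; exact: (ck_int1 ckK).
Qed.

Lemma ncob_avg n f x : l2c dT mu eT n f ->
  avg K n.+1 (ncob n f) x = ncob n (avg K n f) x.
Proof.
move=> lf; have [mf _] := lf.
(* Additivity requires each face to be integrable by itself; composed with a face, [f] is again an
   l^2 cochain by the ball bound. *)
have h (i : 'I_n.+2) : cint (kE K n.+2 x) (fun z => f (z \o bump i)).
  apply: (@cint_kE n.+1); case: lf => _ ef; split; first exact: cmeas_bump.
  move=> r r0; have [B bB] := cs_ball csT r.
  have B0 : 0 <= B%:E by exact: le_trans (measure_ge0 _ _) (bB point).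
  apply: le_lt_trans (energy_bump eT csT _ mf bB) _; first by rewrite -ltnS.
  by rewrite lte_mul_pinfty// ef.
rewrite /avg /ncob (cE_sum (kE_positive _ _)); last first.
  by move=> i; apply: cintZ (kE_positive _ _) _ _ _.
apply: eq_bigr => i _; rewrite (cEZ (kE_positive _ _))//.
by rewrite avg_bump// -ltnS.
Qed.

End kernel_average.

(** * Composition of kernels *)

Section kernel_composition.
Context {d1 d2 d3 : measure_display} {S : measurableType d1} {U : measurableType d2}
  {T : measurableType d3} {R : realType}.
Variables (dS : S -> S -> R) (nu : {sigma_finite_measure set S -> \bar R}).
Variables (dU : U -> U -> R) (ka : {sigma_finite_measure set U -> \bar R}) (eU : U).
Variables (dT : T -> T -> R) (mu : {sigma_finite_measure set T -> \bar R}) (eT : T).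
Variables (K1 : S -> U -> \bar R) (K2 : U -> T -> \bar R) (C1 C2 : R).
Hypothesis csT : coarse_space dT mu.
Hypothesis ck1 : coarse_kernel dS nu dU ka K1 C1.
Hypothesis ck2 : coarse_kernel dU ka dT mu K2 C2.
Local Open Scope ereal_scope.

Definition kcomp s t := \int[ka]_u (K1 s u * K2 u t).

Let mK1 := ck_meas ck1.
Let mK2 := ck_meas ck2.
Let K10 := ck_ge0 ck1.
Let K20 := ck_ge0 ck2.

Let mK1l s : measurable_fun setT (K1 s).
Proof. exact: (measurableT_comp mK1 (pair1_measurable s)). Qed.
Let mK1r u : measurable_fun setT (K1 ^~ u).
Proof. exact: (measurableT_comp mK1 (pair2_measurable u)). Qed.
Let mK2l u : measurable_fun setT (K2 u).
Proof. exact: (measurableT_comp mK2 (pair1_measurable u)). Qed.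
Let mK2r t : measurable_fun setT (K2 ^~ t).
Proof. exact: (measurableT_comp mK2 (pair2_measurable t)). Qed.

Lemma kcomp_supp s t : kcomp s t != 0 -> exists2 u, K1 s u != 0 & K2 u t != 0.
Proof.
move=> h; apply: contrapT => nh; move/eqP: h; apply.
apply: integral0_eq => u _; have [->|k1] := eqVneq (K1 s u) 0; first by rewrite mul0e.
have [->|k2] := eqVneq (K2 u t) 0; first by rewrite mule0.
by exfalso; apply: nh; exists u.
Qed.

Lemma coarse_kernel_comp : exists C, coarse_kernel dS nu dT mu kcomp C.
Proof.
have C10 := ck_bound_ge0 ck1; have C20 := ck_bound_ge0 ck2.
have mKK : measurable_fun setT (fun p : S * T * U => K1 p.1.1 p.2 * K2 p.2 p.1.2).
  apply: emeasurable_funM.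
    apply: (measurableT_comp mK1 (g := fun p : S * T * U => (p.1.1, p.2))).
    by apply: measurable_fun_pair => //; exact: measurableT_comp.
  apply: (measurableT_comp mK2 (g := fun p : S * T * U => (p.2, p.1.2))).
  by apply: measurable_fun_pair => //; exact: measurableT_comp.
(* [C2] bounds the supremum and [C1 * C2] the integral over [s]; the sum covers both. *)
exists (C1 * C2 + C2)%R; split.
- exact: (@measurable_integral_param _ _ (S * T)%type U R ka
    (fun p u => K1 p.1 u * K2 u p.2) mKK (fun p u => mule_ge0 (K10 _ _) (K20 _ _))).
- by move=> s t; apply: integral_ge0 => u _; rewrite mule_ge0.
- move=> s t; apply: (@le_trans _ _ (\int[ka]_u (C2%:E * K1 s u))).
    apply: ge0_le_integralT => u; first by rewrite mule_ge0.
    by rewrite muleC lee_wpmul2r//; exact: (ck_le ck2).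
  rewrite ge0_integralZlT// (ck_int1 ck1) mule1 lee_fin lerDr.
  by rewrite mulr_ge0// -lee_fin.
- move=> s; rewrite integral_exchange//; last 2 first.
  + apply: (measurableT_comp mKK (g := fun p : T * U => ((s, p.1), p.2))).
    apply: measurable_fun_pair => //; apply: measurable_fun_pair => //.
  + by move=> t u; rewrite mule_ge0.
  under eq_integral => u _ do rewrite ge0_integralZlT// (ck_int1 ck2) mule1.
  exact: (ck_int1 ck1).
- move=> t; rewrite integral_exchange//; last 2 first.
  + apply: (measurableT_comp mKK (g := fun p : S * U => ((p.1, t), p.2))).
    apply: measurable_fun_pair => //; apply: measurable_fun_pair => //.
  + by move=> s u; rewrite mule_ge0.
  apply: (@le_trans _ _ (\int[ka]_u (C1%:E * K2 u t))).
    apply: ge0_le_integralT => u.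
      by apply: integral_ge0 => s _; rewrite mule_ge0.
    under eq_integral do rewrite muleC.
    rewrite ge0_integralZlT// muleC lee_wpmul2r//; exact: (ck_int2 ck1).
  rewrite ge0_integralZlT//.
  apply: (@le_trans _ _ (C1%:E * C2%:E)).
    by rewrite lee_wpmul2l//; exact: (ck_int2 ck2).
  by rewrite -EFinM lee_fin lerDl -lee_fin.
- move=> r; have [r1 h1] := ck_ctl ck1 r; have [r2 h2] := ck_ctl ck2 r1.
  exists r2 => s s' t t' /kcomp_supp[u k1 k2] /kcomp_supp[u' k1' k2'] ss'.
  by apply: (h2 u u') => //; exact: (h1 s s').
Qed.

(** Tonelli treats [g^\+] and [g^\-] separately. The outer integrand is the average of [g^\+] minus
    that of [g^\-], both finite at every point, so [fine] loses nothing and [sE_diff] applies to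
    this decomposition. *)
Lemma avg_avg n f x : l2c dT mu eT n f ->
  avg ka eU K1 n (avg mu eT K2 n f) x = avg mu eT kcomp n f x.
Proof.
move=> lf; have [C ckC] := coarse_kernel_comp.
have [mf _] := lf; have p1 := kE_positive eU ck1 n.+1 x.
have h (g : coord_space nat T -> R) : measurable_fun setT g ->
    (forall y, sint (kE mu eT K2 n.+1 y) g) -> sint (kE mu eT kcomp n.+1 x) g ->
    sE (kE ka eU K1 n.+1 x) (fun y => sE (kE mu eT K2 n.+1 y) g) =
    sE (kE mu eT kcomp n.+1 x) g.
  move=> mg g2 gc.
  have [mp mq Ep Eq] := sint_pos_neg (kE_positive eT ckC n.+1 x) gc.
  have key (p : coord_space nat T -> R) : measurable_fun setT p ->
      (forall z, 0 <= p z)%R ->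
      (forall y, kE mu eT K2 n.+1 y (fun z => (p z)%:E) < +oo) ->
      kE ka eU K1 n.+1 x (fun y => (fine (kE mu eT K2 n.+1 y (fun z => (p z)%:E)))%:E) =
      kE mu eT kcomp n.+1 x (fun z => (p z)%:E).
    move=> mp' p0 pf; have p0' z : 0 <= (p z)%:E by rewrite lee_fin.
    transitivity (kE ka eU K1 n.+1 x (fun y => kE mu eT K2 n.+1 y (fun z => (p z)%:E))).
      congr kE; apply/funext => y; rewrite fineK// ge0_fin_numE ?pf//.
      exact: (kE_ge0 eT ck2).
    rewrite [LHS](integral_kE_snd eT ck2)//.
    exact/measurable_EFinP.
  have mk (p : coord_space nat T -> R) : measurable_fun setT p ->
      (forall z, 0 <= p z)%R ->
      measurable_fun setT (fun y : coord_space nat U =>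
        fine (kE mu eT K2 n.+1 y (fun z => (p z)%:E))).
    move=> mp' p0; apply: (measurableT_comp (fine_measurable measurableT)) => //.
    apply: (measurable_kE eT ck2 n.+1 (F := fun _ z => (p z)%:E)).
      have h := measurableT_comp mp' (measurable_snd (T1 := coord_space nat U)).
      exact/measurable_EFinP.
    by move=> y z; rewrite lee_fin.
  have g2p y : kE mu eT K2 n.+1 y (fun z => (g^\+ z)%R%:E) < +oo.
    by have [] := sint_pos_neg (kE_positive eT ck2 n.+1 y) (g2 y).
  have g2n y : kE mu eT K2 n.+1 y (fun z => (g^\- z)%R%:E) < +oo.
    by have [] := sint_pos_neg (kE_positive eT ck2 n.+1 y) (g2 y).
  have p0 y : (0 <= fine (kE mu eT K2 n.+1 y (fun z => (g^\+ z)%R%:E)))%R.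
    by apply/fine_ge0/(kE_ge0 eT ck2) => z; rewrite lee_fin.
  have q0 y : (0 <= fine (kE mu eT K2 n.+1 y (fun z => (g^\- z)%R%:E)))%R.
    by apply/fine_ge0/(kE_ge0 eT ck2) => z; rewrite lee_fin.
  have kp := key _ mp (@funrpos_ge0 _ _ g) g2p.
  have kq := key _ mq (@funrneg_ge0 _ _ g) g2n.
  have := sE_diff p1 (mk _ mp (@funrpos_ge0 _ _ g)) (mk _ mq (@funrneg_ge0 _ _ g))
    p0 q0.
  by rewrite kp kq => /(_ _ Ep Eq); apply.
have i2 y := cint_kE csT ck2 y lf; have [rc ic] := cint_kE csT ckC x lf.
have [rf if_] := mf; rewrite /avg /cE; congr (_ +i* _)%C.
  by apply: (h (@complex.Re R \o f)) => // y; case: (i2 y).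
by apply: (h (@complex.Im R \o f)) => // y; case: (i2 y).
Qed.

End kernel_composition.

(** * The prism homotopy *)

Section prism_identity.

(** The prism identity in abstract form: [A j i] is the i-th face of the j-th simplex of a prism,
    [B j i] the j-th simplex of the prism over the i-th face, and [M j] are the walls shared by
    consecutive simplices, which telescope. *)
Lemma prism_sum (V : comPzRingType) (A B : nat -> nat -> V) (M : nat -> V) n :
  (forall i j, (i <= j)%N -> A j.+1 i = B j i) ->
  (forall i j, (j < i)%N -> A j i.+1 = B j i) ->
  (forall j, A j j = M j) -> (forall j, A j j.+1 = M j.+1) ->
  \sum_(j < n.+1) (-1) ^+ j * \sum_(i < n.+2) (-1) ^+ i * A j i +
  \sum_(i < n.+1) (-1) ^+ i * \sum_(j < n) (-1) ^+ j * B j i = M 0%N - M n.+1.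
Proof.
move=> AB1 AB2 AM1 AM2; elim: n => [|n IH].
  rewrite !big_ord_recr !big_ord0 /= AM1 AM2; ring.
rewrite big_ord_recr [X in _ + X = _]big_ord_recr /=.
under eq_bigr => j _ do rewrite big_ord_recr mulrDr /=.
rewrite big_split /=.
under [X in _ + (X + _) = _]eq_bigr => i _ do rewrite big_ord_recr mulrDr /=.
rewrite [X in _ + (X + _) = _]big_split /=.
have -> : M 0%N - M n.+2 = (M 0%N - M n.+1) + (M n.+1 - M n.+2) by ring.
rewrite -IH.
(* The induction step adds the terms [B j n.+1], collected in [p] and [q], and the terms [B n i],
   collected in [s]. Each group occurs twice with opposite signs; only two walls survive. *)
pose q := B n n.+1; pose p := \sum_(j < n) (-1) ^+ j * B j n.+1.
pose s := \sum_(i < n.+1) (-1) ^+ i * B n i.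
have ee : ((-1) ^+ n * (-1) ^+ n = 1 :> V) by rewrite -expr2 sqrr_sign.
have -> : \sum_(i < n.+1) (-1) ^+ i * ((-1) ^+ n.+2 * A i n.+2) =
    (-1) ^+ n * (p + (-1) ^+ n * q).
  rewrite -[p + _](big_ord_recr n (fun j => (-1) ^+ j * B j n.+1)) mulr_sumr.
  by apply: eq_bigr => j _; rewrite AB2// !exprS; ring.
have -> : \sum_(i < n.+3) (-1) ^+ i * A n.+1 i =
    s + (-1) ^+ n.+1 * M n.+1 + (-1) ^+ n.+2 * M n.+2.
  rewrite 2!big_ord_recr /= AM1 AM2; congr (_ + _ + _).
  by apply: eq_bigr => i _; rewrite AB1// -ltnS.
have -> : \sum_(i < n.+1) (-1) ^+ i * ((-1) ^+ n * B n i) = (-1) ^+ n * s.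
  by rewrite mulr_sumr; apply: eq_bigr => i _; rewrite mulrCA.
have -> : \sum_(j < n.+1) (-1) ^+ j * B j n.+1 = p + (-1) ^+ n * q.
  by rewrite big_ord_recr.
rewrite !exprS; set a := \sum_(_ < _) _; set b := \sum_(_ < _) _.
move: ee; move: ((-1) ^+ n) => ep ee.
apply/eqP; rewrite -subr_eq0; apply/eqP.
transitivity ((ep * ep - 1) * (M n.+1 - M n.+2)); first by ring.
by rewrite ee subrr mul0r.
Qed.

Variable T : Type.

(** The walls: [mixc 0 x z] is [z], and [mixc n.+1 x z] agrees with [x] in the coordinates
    [0, .., n]. *)
Definition mixc (j : nat) (x z : nat -> T) : nat -> T :=
  fun l => if (l < j)%N then x l else z l.

End prism_identity.

Section prism_faces.
Context {d : measure_display} {T : measurableType d}.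
Implicit Types x z : nat -> T.

Lemma prism_face_le i j x z : (i <= j)%N ->
  prism j.+1 x z \o bump i = prism j (x \o bump i) (z \o bump i).
Proof.
move=> ij; apply/funext => l; rewrite /prism /=.
have -> : (bump i l <= j.+1)%N = (l <= j)%N by rewrite /bump; case: (leqP i l) => /=; lia.
case: (leqP l j) => // jl.
by congr z; rewrite /bump; case: (leqP i l); case: (leqP i l.-1) => /=; lia.
Qed.

Lemma prism_face_gt i j x z : (j < i)%N ->
  prism j x z \o bump i.+1 = prism j (x \o bump i) (z \o bump i).
Proof.
move=> ji; apply/funext => l; rewrite /prism /=.
have -> : (bump i.+1 l <= j)%N = (l <= j)%N.
  by rewrite /bump; case: (leqP i.+1 l) => /=; lia.
case: (leqP l j) => jl.
  by congr x; rewrite /bump; case: (leqP i l); case: (leqP i.+1 l) => /=; lia.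
by congr z; rewrite /bump; case: (leqP i.+1 l); case: (leqP i l.-1) => /=; lia.
Qed.

Lemma prism_face_eq j x z : prism j x z \o bump j = mixc j x z.
Proof.
apply/funext => l; rewrite /prism /mixc /=.
have -> : (bump j l <= j)%N = (l < j)%N.
  by rewrite /bump; case: (leqP j l) => /=; lia.
case: (ltnP l j) => jl.
  by congr x; rewrite /bump; case: (leqP j l) => /=; lia.
by congr z; rewrite /bump; case: (leqP j l) => /=; lia.
Qed.

Lemma prism_face_eqS j x z : prism j x z \o bump j.+1 = mixc j.+1 x z.
Proof.
apply/funext => l; rewrite /prism /mixc /=.
have -> : (bump j.+1 l <= j)%N = (l < j.+1)%N.
  by rewrite /bump; case: (leqP j.+1 l) => /=; lia.
case: (ltnP l j.+1) => jl.
  by congr x; rewrite /bump; case: (leqP j.+1 l) => /=; lia.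
by congr z; rewrite /bump; case: (leqP j.+1 l) => /=; lia.
Qed.

(** [dep] identifies the value at the last wall with [f x], since beyond coordinate [n] that wall
    follows [z]. The second sum is written out, rather than as a coboundary, to include degree 0,
    where its inner sum is empty. *)
Lemma ncob_prism (R : realType) (f : (nat -> T) -> R[i]) n x z :
  (forall y y', (forall i, (i <= n)%N -> y i = y' i) -> f y = f y') ->
  \sum_(j < n.+1) (-1) ^+ j * ncob n f (prism j x z) +
  \sum_(i < n.+1) (-1) ^+ i * \sum_(j < n) (-1) ^+ j *
    f (prism j (x \o bump i) (z \o bump i)) = f z - f x.
Proof.
move=> dep; rewrite /ncob.
rewrite (prism_sum (A := fun j i => f (prism j x z \o bump i))
  (B := fun j i => f (prism j (x \o bump i) (z \o bump i)))
  (M := fun j => f (mixc j x z))).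
- congr (_ - _).
  by apply: dep => i ni; rewrite /mixc ltnS ni.
- by move=> i j ij; rewrite prism_face_le.
- by move=> i j ij; rewrite prism_face_gt.
- by move=> j; rewrite prism_face_eq.
- by move=> j; rewrite prism_face_eqS.
Qed.

End prism_faces.

(** * The homotopy operator and its estimates *)

Section homotopy.
Context {d : measure_display} {T : measurableType d} {R : realType}.
Variables (dist : T -> T -> R) (mu : {sigma_finite_measure set T -> \bar R}) (e : T).
Variables (K : T -> T -> \bar R) (C D : R).
Hypothesis csT : coarse_space dist mu.
Hypothesis ckK : coarse_kernel dist mu dist mu K C.
Hypothesis supK : forall s t, K s t != 0%E -> dist s t <= D.
Local Open Scope ereal_scope.

Let K0 := ck_ge0 ckK.
Let mK := ck_meas ckK.

Let m1 : forall i : nat, measurable_fun setT (fun _ : T => 1 : \bar R).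
Proof. by move=> _; exact: measurable_cst. Qed.

(** Where this is finite, every integral in [prism_op n g x] converges absolutely, the weights
    having total mass 1. It is the majorant whose infinity set is discarded. *)
Definition prism_energy n (g : (nat -> T) -> R[i]) (x : nat -> T) : \bar R :=
  \sum_(j < n.+1) kE mu e K n.+1 x (fun z => (nsq (g (prism j x z)))%:E).

Definition prism_op n (g : (nat -> T) -> R[i]) (x : nat -> T) : R[i] :=
  (\sum_(j < n.+1) (-1) ^+ j * cE (kE mu e K n.+1 x) (fun z => g (prism j x z)))%R.

Lemma prism_op_ext n g (x y : nat -> T) : (forall i, (i <= n)%N -> x i = y i) ->
  prism_op n g x = prism_op n g y.
Proof.
move=> xy; apply: eq_bigr => j _; congr (_ * _)%R.
have -> : (fun z => g (prism j x z)) = (fun z => g (prism j y z)).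
  apply/funext => z; congr g; apply/funext => l; rewrite /prism.
  by case: (leqP l j) => // lj; rewrite xy// (leq_trans lj)// -ltnS.
by apply: eq_cE_witer => // i t; rewrite ltnS => ni; rewrite xy.
Qed.

Let cmeas_prism2 j (g : (nat -> T) -> R[i]) :
  cmeas (g : coord_space nat T -> R[i]) ->
  cmeas (fun p : coord_space nat T * coord_space nat T => g (prism j p.1 p.2)).
Proof.
case=> rg ig; split.
  exact: (measurableT_comp rg (measurable_prism j)).
exact: (measurableT_comp ig (measurable_prism j)).
Qed.

Let cmeas_prism1 j (g : (nat -> T) -> R[i]) x :
  cmeas (g : coord_space nat T -> R[i]) ->
  cmeas (fun z : coord_space nat T => g (prism j x z)).
Proof.
move=> /(cmeas_prism2 j)[rg ig]; split.
  exact: (measurableT_comp rg (@pair1_measurable _ _ (coord_space nat T)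
    (coord_space nat T) x)).
exact: (measurableT_comp ig (@pair1_measurable _ _ (coord_space nat T)
    (coord_space nat T) x)).
Qed.

Lemma cmeas_prism_op n (g : (nat -> T) -> R[i]) :
  cmeas (g : coord_space nat T -> R[i]) ->
  cmeas (prism_op n g : coord_space nat T -> R[i]).
Proof.
move=> mg; apply: cmeas_sum => j; apply: cmeasZ.
by apply: (cmeas_cE_kE e ckK n.+1 (f := fun x z => g (prism j x z))); exact: cmeas_prism2.
Qed.

Let nsq0 (g : (nat -> T) -> R[i]) (z : nat -> T) : 0 <= (nsq (g z))%:E.
Proof. by rewrite lee_fin nsq_ge0. Qed.

Let term_ge0 n j g x : 0 <= kE mu e K n x (fun z => (nsq (g (prism j x z)))%:E).
Proof. by apply: (kE_ge0 e ckK) => z. Qed.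

Let measurable_term n j (g : (nat -> T) -> R[i]) :
  cmeas (g : coord_space nat T -> R[i]) ->
  measurable_fun setT (fun x : coord_space nat T =>
    kE mu e K n x (fun z => (nsq (g (prism j x z)))%:E)).
Proof.
move=> mg; apply: (measurable_kE e ckK n
  (F := fun x z => (nsq (g (prism j x z)))%:E)) => [|x z]; last exact: nsq0.
by apply: measurable_nsq; exact: cmeas_prism2.
Qed.

Lemma prism_energy_ge0 n g x : 0 <= prism_energy n g x.
Proof. by apply: sume_ge0 => j _. Qed.

Lemma measurable_prism_energy n (g : (nat -> T) -> R[i]) :
  cmeas (g : coord_space nat T -> R[i]) ->
  measurable_fun setT (prism_energy n g : coord_space nat T -> \bar R).
Proof. by move=> mg; apply: emeasurable_sum => j _; exact: measurable_term. Qed.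

(** The longest connection runs through [z_i], [x_i], [x_i'], [z_i']; the extra 1 keeps the radius
    positive. *)
Let near_prism r n j x z : (j <= n)%N -> near_tuple dist r n x ->
  (forall i, (i <= n)%N -> K (x i) (z i) != 0) ->
  near_tuple dist (`|r| + 2 * `|D| + 1) n.+1 (prism j x z).
Proof.
move=> jn nx Kz a b na nb.
have xx i i' : (i <= n)%N -> (i' <= n)%N -> (dist (x i) (x i') <= `|r|)%R.
  by move=> ni ni'; apply: le_trans (nx _ _ ni ni') _; rewrite ler_norm.
have xz i : (i <= n)%N -> (dist (x i) (z i) <= `|D|)%R.
  by move=> ni; apply: le_trans (supK (Kz _ ni)) _; rewrite ler_norm.
have r0 : (0 <= `|r|)%R by []. have D0 : (0 <= `|D|)%R by [].
have xz' i i' : (i <= n)%N -> (i' <= n)%N -> (dist (x i) (z i') <= `|r| + `|D|)%R.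
  move=> ni ni'; apply: le_trans (cs_tri csT _ (x i') _) _.
  by rewrite lerD ?xx ?xz.
have zz' i i' : (i <= n)%N -> (i' <= n)%N -> (dist (z i) (z i') <= `|r| + 2 * `|D|)%R.
  move=> ni ni'; apply: le_trans (cs_tri csT _ (x i) _) _.
  rewrite (cs_sym csT (z i)).
  by have := xz _ ni; have := xz' _ _ ni ni'; lra.
rewrite /prism; case: (leqP a j) => aj; case: (leqP b j) => bj.
- have := @xx a b; rewrite !(leq_trans _ jn)// => /(_ isT isT); lra.
- have := @xz' a b.-1; rewrite (leq_trans aj jn) => /(_ isT).
  have -> : (b.-1 <= n)%N by lia.
  by move=> /(_ isT); lra.
- have := @xz' b a.-1; rewrite (leq_trans bj jn) => /(_ isT).
  have -> : (a.-1 <= n)%N by lia.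
  by move=> /(_ isT); rewrite (cs_sym csT (x b)); lra.
- have := @zz' a.-1 b.-1; have -> : (a.-1 <= n)%N by lia.
  have -> : (b.-1 <= n)%N by lia.
  by move=> /(_ isT isT); lra.
Qed.

Lemma witer_sum m (F : 'I_m -> (nat -> T) -> \bar R) k x :
  (forall i, measurable_fun setT (F i : coord_space nat T -> \bar R)) ->
  (forall i y, 0 <= F i y) ->
  witer mu (fun _ _ => 1) k (fun y => \sum_(i < m) F i y) x =
  \sum_(i < m) witer mu (fun _ _ => 1) k (F i) x.
Proof.
elim: m F => [|m IH] F mF F0.
  rewrite big_ord0; under eq_witer_fun do rewrite big_ord0.
  rewrite (_ : (fun=> 0) = (fun y : coord_space nat T => 0 * cst 0 y)).
    by rewrite witerZ// mul0e.
  by apply/funext => y; rewrite mul0e.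
rewrite big_ord_recl; under eq_witer_fun do rewrite big_ord_recl.
rewrite witerD// ?IH//; first by apply: emeasurable_sum => i _; exact: mF.
by move=> y; apply: sume_ge0 => i _; exact: F0.
Qed.

Lemma prism_energy_bound r n : exists r' C' : R, [/\ (0 < r')%R, (0 <= C')%R &
  forall g, cmeas (g : coord_space nat T -> R[i]) ->
    witer mu (fun _ _ => 1) n.+1 (cut dist r n (prism_energy n g)) (fun=> e) <=
    C'%:E * energy dist mu e r' n.+1 g].
Proof.
have := ck_bound_ge0 ckK; rewrite lee_fin => C0.
(* [C + 1] bounds the supremum of [K] and both of its marginals, one of which is 1. *)
pose Q := (C + 1)%R; have Q0 : (0 <= Q)%R by rewrite addr_ge0.
pose r' := (`|r| + 2 * `|D| + 1)%R.
exists r', (\sum_(j < n.+1) Q ^+ n.+1)%R; split.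
- by rewrite ltr_wpDl// addr_ge0// mulr_ge0.
- by apply: sumr_ge0 => j _; rewrite exprn_ge0.
move=> g mg.
have -> : cut dist r n (prism_energy n g) = (fun x => \sum_(j < n.+1)
    cut dist r n (fun x => kE mu e K n.+1 x (fun z => (nsq (g (prism j x z)))%:E)) x).
  apply/funext => x; rewrite /cut; case: asboolP => // _.
  by rewrite big1.
rewrite witer_sum//; last 2 first.
- by move=> j; apply: (measurable_cut (cs_meas csT)); exact: measurable_term.
- by move=> j y; exact: cut_ge0.
pose F := cut dist r' n.+1 (fun z => (nsq (g z))%:E).
have mF : measurable_fun setT (F : coord_space nat T -> \bar R).
  by apply: (measurable_cut (cs_meas csT)); exact: measurable_nsq.
have F0 z : 0 <= F z by exact: cut_ge0.
apply: (@le_trans _ _ (\sum_(j < n.+1) (Q ^+ n.+1)%:E * energy dist mu e r' n.+1 g)).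
  apply: lee_sum => j _.
  apply: (@le_trans _ _ (witer mu (fun _ _ => 1) n.+1
      (fun x => kE mu e K n.+1 x (fun z => F (prism j x z))) (fun=> e))).
    apply: le_witer => //.
    - by move=> x; exact: cut_ge0.
    - by move=> x; apply: (kE_ge0 e ckK) => z; exact: F0.
    move=> x _ _; rewrite {1}/cut; case: asboolP => nx; last first.
      by apply: (kE_ge0 e ckK) => z; exact: F0.
    apply: le_witer => [i t|i t|z|z|//|z Kz _]; [exact: K0|exact: K0| |exact: F0|].
      exact: nsq0.
    rewrite /F /cut asboolT//.
    have jn : (j <= n)%N by rewrite -ltnS.
    by apply: (near_prism jn nx) => i ni; exact: Kz.
  rewrite (witer_witer mu mu (fun i => m1 i) _ mK K0 n.+1
    (F := fun x z => F (prism j x z)))//; last first.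
    exact: (measurableT_comp mF (measurable_prism j)).
  have KQ s t : K s t <= Q%:E.
    by apply: le_trans (ck_le ckK _ _) _; rewrite lee_fin lerDl.
  apply: le_trans (@piter_prism _ _ _ mu K Q mK K0 KQ _ _ n.+1 j F _ _ mF F0) _.
  - by move=> s; rewrite (ck_int1 ckK) lee_fin lerDr.
  - by move=> t; apply: le_trans (ck_int2 ckK _) _; rewrite lee_fin lerDl.
  (* The [n.+1] pairs include the pair [j], so [n.+2] vertices are integrated, as many as an
     (n+1)-cochain has. *)
  rewrite ltn_ord addn1 (_ : prism j _ _ = fun=> e)//.
  by apply/funext => l; rewrite /prism if_same.
by rewrite -ge0_sume_distrl ?sumEFin// => j _; rewrite lee_fin exprn_ge0.
Qed.

Lemma nsq_prism_op n (g : (nat -> T) -> R[i]) x :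
  cmeas (g : coord_space nat T -> R[i]) ->
  (nsq (prism_op n g x))%:E <= (2 ^+ n.+1)%:E * prism_energy n g x.
Proof.
move=> mg; apply: (@le_trans _ _ ((2 ^+ n.+1)%:E * \sum_(j < n.+1)
    (nsq (cE (kE mu e K n.+1 x) (fun z => g (prism j x z))))%:E)).
  rewrite sumEFin -EFinM lee_fin; apply: le_trans (nsq_sum_le _) _.
  by rewrite ler_pM2l ?exprn_gt0//; apply: ler_sum => j _; rewrite nsqM nsq_sign mul1r.
apply: lee_wpmul2l; first by rewrite lee_fin exprn_ge0.
apply: lee_sum => j _.
exact: (cE_nsq (kE_positive e ckK n.+1 x) (kE1 e ckK n.+1 x) (cmeas_prism1 j x mg)).
Qed.

Lemma energy_prism_op r n : exists r' C' : R, [/\ (0 < r')%R, (0 <= C')%R &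
  forall g, cmeas (g : coord_space nat T -> R[i]) ->
    energy dist mu e r n (prism_op n g) <= C'%:E * energy dist mu e r' n.+1 g].
Proof.
have [r' [C' [r'0 C'0 h]]] := prism_energy_bound r n.
exists r', (2 ^+ n.+1 * C')%R; split => //; first by rewrite mulr_ge0// exprn_ge0.
move=> g mg; rewrite EFinM -muleA.
apply: le_trans (lee_wpmul2l _ (h _ mg)); last by rewrite lee_fin exprn_ge0.
have mcp : measurable_fun setT (cut dist r n (prism_energy n g)
    : coord_space nat T -> \bar R).
  by apply: (measurable_cut (cs_meas csT)); exact: measurable_prism_energy.
have cp0 y : 0 <= cut dist r n (prism_energy n g) y.
  by apply: cut_ge0 => z; exact: prism_energy_ge0.
have p2 : 0 <= (2 ^+ n.+1)%:E :> \bar R by rewrite lee_fin exprn_ge0.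
rewrite -witerZ//.
apply: le_witer => [//|//|y|y|//|y _ _].
- by apply: cut_ge0 => z; exact: nsq0.
- by rewrite mule_ge0.
rewrite /cut; case: asboolP => _; last by rewrite mule0.
exact: nsq_prism_op.
Qed.

Lemma l2c_prism_op n g : l2c dist mu e n.+1 g -> l2c dist mu e n (prism_op n g).
Proof.
case=> mg eg; split; first exact: cmeas_prism_op.
move=> r _; have [r' [C' [r'0 C'0 h]]] := energy_prism_op r n.
by apply: le_lt_trans (h _ mg) _; rewrite lte_mul_pinfty// eg.
Qed.

Definition depends_upto n (f : (nat -> T) -> R[i]) :=
  forall y y', (forall i, (i <= n)%N -> y i = y' i) -> f y = f y'.

(** The finiteness hypotheses allow [ncob_prism] to be integrated over [z] term by term. A term over
    the i-th face involves [z] only through that face, so [z_i] integrates out and an average with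
    one variable less remains. *)
Lemma homotopy_pointwise n f x : l2c dist mu e n f -> depends_upto n f ->
  (forall j, (j <= n)%N ->
    kE mu e K n.+1 x (fun z => (nsq (ncob n f (prism j x z)))%:E) < +oo) ->
  (forall i j, (i <= n)%N -> (j < n)%N -> kE mu e K n (x \o bump i)
    (fun z => (nsq (f (prism j (x \o bump i) z)))%:E) < +oo) ->
  (avg mu e K n f x - f x = prism_op n (ncob n f) x +
  \sum_(i < n.+1) (-1) ^+ i * \sum_(j < n) (-1) ^+ j *
    cE (kE mu e K n (x \o bump i)) (fun z => f (prism j (x \o bump i) z)))%R.
Proof.
move=> lf dep fin1 fin2; have [mf _] := lf.
have [mcf _] := l2c_ncob csT lf.
have pE := kE_positive e ckK n.+1 x; have E1 := kE1 e ckK n.+1 x.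
have ci1 (j : 'I_n.+1) : cint (kE mu e K n.+1 x) (fun z => ncob n f (prism j x z)).
  apply: (cint_nsq pE E1); first exact: cmeas_prism1.
  by apply: fin1; rewrite -ltnS.
have mb i j : cmeas (fun z : coord_space nat T => f (prism j (x \o bump i) (z \o bump i))).
  exact: (cmeas_bump i (cmeas_prism1 j (x \o bump i) mf)).
have ci2 (i : 'I_n.+1) (j : 'I_n) : cint (kE mu e K n.+1 x)
    (fun z => f (prism j (x \o bump i) (z \o bump i))).
  apply: (cint_nsq pE E1); first exact: mb.
  rewrite /kE /wE (@witer_bump _ _ _ mu _ n i
    (fun z => (nsq (f (prism j (x \o bump i) z)))%:E))//.
  - by apply: fin2 => //; rewrite -ltnS.
  - by rewrite -ltnS.
  - by move=> i'; exact: (measurable_kernel_coord mK i' x).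
  - exact: (ck_int1 ckK).
  - by apply: measurable_nsq; exact: cmeas_prism1.
have cif := cint_kE csT ckK x lf.
have cic : cint (kE mu e K n.+1 x) (fun=> (-1 * f x)%R).
  apply: (cint_nsq pE E1); first by split; exact: measurable_cst.
  by rewrite (pfun_cst pE E1) ?ltry// nsq_ge0.
have -> : (avg mu e K n f x - f x =
    cE (kE mu e K n.+1 x) (fun z => f z + -1 * f x))%R.
  by rewrite (cED pE)// (cE_cst pE E1) mulN1r.
have -> : (fun z => f z + -1 * f x)%R = (fun z =>
    \sum_(j < n.+1) (-1) ^+ j * ncob n f (prism j x z) +
    \sum_(i < n.+1) (-1) ^+ i * \sum_(j < n) (-1) ^+ j *
      f (prism j (x \o bump i) (z \o bump i)))%R.
  by apply/funext => z; rewrite ncob_prism// mulN1r.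
have ci3 (i : 'I_n.+1) : cint (kE mu e K n.+1 x) (fun z => \sum_(j < n) (-1) ^+ j *
      f (prism j (x \o bump i) (z \o bump i)))%R.
  by apply: (cint_sum pE) => j; exact: (cintZ pE).
rewrite (cED pE); last 2 first.
- by apply: (cint_sum pE) => j; exact: (cintZ pE).
- by apply: (cint_sum pE) => i; exact: (cintZ pE).
congr (_ + _)%R.
  rewrite (cE_sum pE); last by move=> j; exact: (cintZ pE).
  by apply: eq_bigr => j _; rewrite (cEZ pE).
rewrite (cE_sum pE); last by move=> i; exact: (cintZ pE).
apply: eq_bigr => i _; rewrite (cEZ pE)//; congr (_ * _)%R.
rewrite (cE_sum pE); last by move=> j; exact: (cintZ pE).
apply: eq_bigr => j _; rewrite (cEZ pE)//; congr (_ * _)%R.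
rewrite /kE (@cE_bump _ _ _ mu _ _ _ n i (fun z => f (prism j (x \o bump i) z)))//.
- by move=> i'; exact: (measurable_kernel_coord mK i' x).
- by rewrite -ltnS.
- exact: (ck_int1 ckK).
- exact: cmeas_prism1.
Qed.

Let sum_lty m (F : 'I_m -> \bar R) : (forall i, 0 <= F i) ->
  \sum_(i < m) F i < +oo -> forall i, F i < +oo.
Proof.
move=> F0 h i; apply: le_lt_trans h; rewrite (bigD1 i)//= leeDl//.
by apply: sume_ge0 => j _.
Qed.

(** A null [g] has a null [prism_op n g] by the energy bound. With [g] the coboundary of a cocycle,
    this discards the term [s d] of the homotopy. *)
Let defect_cocycle r n f g : (0 < r)%R ->
  cmeas (f : coord_space nat T -> R[i]) -> l2c dist mu e n.+1 g ->
  (forall r, (0 < r)%R -> energy dist mu e r n.+1 g = 0) ->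
  energy dist mu e r n (fun x => f x - prism_op n g x)%R = 0 ->
  energy dist mu e r n f = 0.
Proof.
move=> r0 mf lg g0 h; have [mg _] := lg.
have [r' [C' [r'0 C'0 hp]]] := energy_prism_op r n.
have p0 : energy dist mu e r n (prism_op n g) = 0.
  apply/eqP; rewrite eq_le energy_ge0 andbT; apply: le_trans (hp _ mg) _.
  by rewrite g0// mule0.
have mp := cmeas_prism_op n mg.
have mfp : cmeas (fun x : coord_space nat T => f x - prism_op n g x)%R.
  have := cmeasD mf (cmeasZ (-1) mp).
  by congr cmeas; apply/funext => x; rewrite mulN1r.
apply/eqP; rewrite eq_le energy_ge0 andbT.
have := energyD e csT r n mfp mp; rewrite h p0 adde0 mule0.
by under eq_fun do rewrite subrK.
Qed.

(** In degree 0 the term [d s] is absent, so a cocycle agrees with its average almost everywhere. *)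
Lemma homotopy_cocycle0 f : l2c dist mu e 0 f -> depends_upto 0 f ->
  (forall r, (0 < r)%R -> energy dist mu e r 1 (ncob 0 f) = 0) ->
  forall r, (0 < r)%R -> energy dist mu e r 0 (fun x => avg mu e K 0 f x - f x)%R = 0.
Proof.
move=> lf dep f0 r r0; have [mf _] := lf.
have ln := l2c_ncob csT lf; have [mn en] := ln.
have ma := cmeas_avg e ckK 0 mf.
apply: (defect_cocycle r0 _ ln f0).
  have := cmeasD ma (cmeasZ (-1) mf).
  by congr cmeas; apply/funext => x; rewrite mulN1r.
have [r' [C' [r'0 C'0 hp]]] := prism_energy_bound r 0.
apply: (null_of_finite_majorant csT (B := prism_energy 0 (ncob 0 f))).
- exact: measurable_prism_energy.
- exact: prism_energy_ge0.
- move=> x Bx; rewrite homotopy_pointwise// => [|j].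
    by rewrite big_ord_recr big_ord0 /= big_ord0 mulr0 !addr0 subrr.
  rewrite leqn0 => /eqP ->.
  exact: (@sum_lty _ (fun j : 'I_1 => kE mu e K 1 x
    (fun z => (nsq (ncob 0 f (prism j x z)))%:E)) _ Bx ord0).
- by apply: le_lt_trans (hp _ mn) _; rewrite lte_mul_pinfty// en.
Qed.

Lemma homotopy_cocycleS n f : l2c dist mu e n.+1 f -> depends_upto n.+1 f ->
  (forall r, (0 < r)%R -> energy dist mu e r n.+2 (ncob n.+1 f) = 0) ->
  forall r, (0 < r)%R -> energy dist mu e r n.+1
    (fun x => avg mu e K n.+1 f x - f x - ncob n (prism_op n f) x)%R = 0.
Proof.
move=> lf dep f0 r r0; have [mf ef] := lf.
have ln := l2c_ncob csT lf; have [mn en] := ln.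
have ma := cmeas_avg e ckK n.+1 mf.
have [mp _] := l2c_ncob csT (l2c_prism_op lf).
apply: (defect_cocycle r0 _ ln f0).
  have := cmeasD (cmeasD ma (cmeasZ (-1) mf)) (cmeasZ (-1) mp).
  by congr cmeas; apply/funext => x; rewrite !mulN1r.
have [r1 [C1 [r10 C10 h1]]] := prism_energy_bound r n.+1.
have [r2 [C2 [r20 C20 h2]]] := prism_energy_bound r n.
have [Cb bC] := cs_ball csT r.
have Cb0 : 0 <= Cb%:E by exact: le_trans (measure_ge0 _ _) (bC point).
have mpe i : measurable_fun setT (fun x : coord_space nat T =>
    prism_energy n f (x \o bump i)).
  exact: (measurableT_comp (measurable_prism_energy n mf) (measurable_bump i)).
have mpe2 := measurable_prism_energy n.+1 mn.
(* The majorant controls both [s d] and [d s]: it adds the prism energy of the coboundary at [x] to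
   those of [f] at all faces of [x], which [witer_face] makes integrable over controlled tuples. *)
apply: (null_of_finite_majorant csT (B := fun x => prism_energy n.+1 (ncob n.+1 f) x +
  \sum_(i < n.+2) prism_energy n f (x \o bump i))).
- by apply: emeasurable_funD => //; apply: emeasurable_sum => i _; exact: mpe.
- move=> x; rewrite adde_ge0 ?prism_energy_ge0//.
  by apply: sume_ge0 => i _; exact: prism_energy_ge0.
- move=> x Bx.
  have B1 : prism_energy n.+1 (ncob n.+1 f) x < +oo.
    apply: le_lt_trans Bx; rewrite leeDl//.
    by apply: sume_ge0 => i _; exact: prism_energy_ge0.
  have B2 (i : 'I_n.+2) : prism_energy n f (x \o bump i) < +oo.
    apply: (@sum_lty _ (fun i : 'I_n.+2 => prism_energy n f (x \o bump i))) => [j|].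
      exact: prism_energy_ge0.
    by apply: le_lt_trans Bx; rewrite leeDr// prism_energy_ge0.
  rewrite homotopy_pointwise//.
  - by rewrite /ncob /prism_op; ring.
  - move=> j; rewrite -ltnS => jn.
    exact: (@sum_lty _ (fun j : 'I_n.+2 => kE mu e K n.+2 x
      (fun z => (nsq (ncob n.+1 f (prism j x z)))%:E)) _ B1 (Ordinal jn)).
  - move=> i j; rewrite -ltnS => ni jn.
    exact: (@sum_lty _ (fun j : 'I_n.+1 => kE mu e K n.+1 (x \o bump i)
      (fun z => (nsq (f (prism j (x \o bump i) z)))%:E)) _
      (B2 (Ordinal ni)) (Ordinal jn)).
have -> : cut dist r n.+1 (fun x => prism_energy n.+1 (ncob n.+1 f) x +
    \sum_(i < n.+2) prism_energy n f (x \o bump i)) =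
    (fun x => cut dist r n.+1 (prism_energy n.+1 (ncob n.+1 f)) x +
      \sum_(i < n.+2) cut dist r n.+1 (fun x => prism_energy n f (x \o bump i)) x).
  apply/funext => x; rewrite /cut; case: asboolP => // _.
  by rewrite big1// adde0.
have mc i : measurable_fun setT (cut dist r n.+1
    (fun x => prism_energy n f (x \o bump i)) : coord_space nat T -> \bar R).
  exact: (measurable_cut (cs_meas csT)).
have c0 i y : 0 <= cut dist r n.+1 (fun x => prism_energy n f (x \o bump i)) y.
  by apply: cut_ge0 => z; exact: prism_energy_ge0.
rewrite witerD//; last 4 first.
- exact: (measurable_cut (cs_meas csT)).
- by move=> y; apply: cut_ge0 => z; exact: prism_energy_ge0.
- by apply: emeasurable_sum => i _; exact: mc.
- by move=> y; apply: sume_ge0 => i _; exact: c0.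
rewrite witer_sum//; apply: lte_add_pinfty.
  by apply: le_lt_trans (h1 _ mn) _; rewrite lte_mul_pinfty// en.
apply: lte_sum_pinfty => i _.
apply: le_lt_trans (witer_face (cs_meas csT) (F := prism_energy n f) _ _ _ _ bC) _.
- by rewrite -ltnS.
- exact: measurable_prism_energy.
- exact: prism_energy_ge0.
rewrite lte_mul_pinfty//; apply: le_lt_trans (h2 _ mf) _.
by rewrite lte_mul_pinfty// ef.
Qed.

End homotopy.

(** * Maps of coarse cochain complexes *)

Section cochain_lifting.
Context {R : realType} {T : ptopologicalType}.
Variables (e : T) (dist : T -> T -> R)
  (mu : {sigma_finite_measure set (Borel T) -> \bar R}).
Hypothesis csT : @coarse_space _ (Borel T) R dist mu.

Definition lift_cochain n (al : cochain R T n) (x : nat -> Borel T) : R[i] :=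
  al (fun i : 'I_n.+1 => x i).

(** [inord] sends indices above [n] to 0, so the tuple is continued by its vertex 0; a lifted
    n-cochain does not see this part. *)
Definition extend_tuple n (x : 'I_n.+1 -> T) : nat -> T := fun i => x (inord i).

Lemma extend_tupleK n (x : 'I_n.+1 -> T) :
  (fun i : 'I_n.+1 => extend_tuple x i) = x.
Proof. by apply/funext => i; rewrite /extend_tuple inord_val. Qed.

Lemma extend_tuple_restrict n (x : nat -> T) i : (i <= n)%N ->
  extend_tuple (fun i : 'I_n.+1 => x i) i = x i.
Proof. by move=> ni; rewrite /extend_tuple inordK. Qed.

Lemma lift_cochain_extend n (al : cochain R T n) x :
  lift_cochain al (extend_tuple x) = al x.
Proof. by rewrite /lift_cochain extend_tupleK. Qed.

Lemma lift_dcob n (al : cochain R T n) : lift_cochain (dcob al) = @ncob _ (Borel T) R n (lift_cochain al).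
Proof. by []. Qed.

Lemma lift_depends n (al : cochain R T n) :
  @depends_upto _ (Borel T) R n (lift_cochain al).
Proof.
move=> x y xy; rewrite /lift_cochain; congr al; apply/funext => i.
by apply: xy; rewrite -ltnS.
Qed.

Lemma iter_intE k F x :
  iter_int mu k F x = @witer _ (Borel T) R mu (fun _ _ => 1%E) k F x.
Proof.
elim: k x => //= k IH x; apply: eq_integral => t _.
by rewrite IH mul1e.
Qed.

Lemma sqnormE r n (al : cochain R T n) :
  sqnorm e dist mu r al = @energy _ (Borel T) R dist mu e r n (lift_cochain al).
Proof.
rewrite /sqnorm /prod_int iter_intE /energy; congr witer.
apply/funext => x; rewrite /cut nsqE.
have -> // : `[< forall i j : 'I_n.+1, dist (x i) (x j) <= r >] =
  `[< @near_tuple _ (Borel T) R dist r n x >].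
apply: asbool_equiv_eq; split => h i j; last by apply: h; rewrite -ltnS.
rewrite -ltnS => ni; rewrite -ltnS => nj.
exact: (h (Ordinal ni) (Ordinal nj)).
Qed.

Lemma cochain_measurableP n (al : cochain R T n) : cochain_measurable al <->
  cmeas (lift_cochain al : coord_space nat (Borel T) -> R[i]).
Proof.
have mr : measurable_fun setT (fun x : coord_space nat (Borel T) =>
    (fun i : 'I_n.+1 => x i) : coord_space 'I_n.+1 (Borel T)).
  by apply: measurable_to_coord => i; exact: measurable_coord.
have me : measurable_fun setT (fun x : coord_space 'I_n.+1 (Borel T) =>
    extend_tuple x : coord_space nat (Borel T)).
  by apply: measurable_to_coord => i; exact: measurable_coord.
split=> [mal|[ral ial] B mB].
  have ral : measurable_fun setT (fun x : coord_space 'I_n.+1 (Borel T) =>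
      complex.Re (al x)).
    by move=> _ B mB; rewrite setTI; exact: (mal B mB).1.
  have ial : measurable_fun setT (fun x : coord_space 'I_n.+1 (Borel T) =>
      complex.Im (al x)).
    by move=> _ B mB; rewrite setTI; exact: (mal B mB).2.
  by split; [exact: (measurableT_comp ral mr)|exact: (measurableT_comp ial mr)].
have := measurableT_comp ral me measurableT mB.
have := measurableT_comp ial me measurableT mB.
rewrite !setTI => hi hr; split.
  rewrite (_ : (fun x => complex.Re (al x)) =
    ((@complex.Re R \o lift_cochain al) \o (@extend_tuple n))); first exact: hr.
  by apply/funext => x /=; rewrite lift_cochain_extend.
rewrite (_ : (fun x => complex.Im (al x)) =
  ((@complex.Im R \o lift_cochain al) \o (@extend_tuple n))); first exact: hi.
by apply/funext => x /=; rewrite lift_cochain_extend.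
Qed.

Lemma CXP n (al : cochain R T n) :
  CX e dist mu n al <-> @l2c _ (Borel T) R dist mu e n (lift_cochain al).
Proof.
split=> -[/cochain_measurableP mal fal]; split => // r r0.
  by rewrite -sqnormE fal.
by rewrite sqnormE fal.
Qed.

Lemma CX_lin n (al be : cochain R T n) (c : R[i]) :
  CX e dist mu n al -> CX e dist mu n be ->
  CX e dist mu n (fun x => al x + c * be x).
Proof. by move=> /CXP a /CXP b; apply/CXP; apply: (l2cD csT a); exact: l2cZ. Qed.

Lemma csubE n (al be : cochain R T n) : csub al be = (fun x => al x + -1 * be x).
Proof. by apply/funext => x; rewrite mulN1r. Qed.

Lemma CX_csub n (al be : cochain R T n) :
  CX e dist mu n al -> CX e dist mu n be -> CX e dist mu n (csub al be).
Proof. by rewrite csubE; exact: CX_lin. Qed.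

Lemma CX_dcob n (al : cochain R T n) :
  CX e dist mu n al -> CX e dist mu n.+1 (dcob al).
Proof. by move=> /CXP a; apply/CXP; exact: (l2c_ncob csT a). Qed.

Lemma csubrr n (al : cochain R T n) : csub al al = (fun=> 0).
Proof. by apply/funext => x; rewrite /csub subrr. Qed.

Lemma sqnorm0 r n : sqnorm e dist mu r ((fun=> 0) : cochain R T n) = 0%E.
Proof.
rewrite sqnormE; have h : @cmeas _ (coord_space nat (Borel T)) R (fun=> 0).
  by split; exact: measurable_cst.
have := energyZ (e : Borel T) csT r n 0 h; rewrite nsq0 mul0e => <-.
by congr energy; apply/funext => x; rewrite mul0r.
Qed.

Lemma null0 n : null_cochain e dist mu ((fun=> 0) : cochain R T n).
Proof. by move=> r _; exact: sqnorm0. Qed.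

Lemma CX0 n : CX e dist mu n (fun=> 0).
Proof.
split; last by move=> r _; rewrite sqnorm0 ltry.
by apply/cochain_measurableP; split; exact: measurable_cst.
Qed.

Lemma dcob0 n : dcob ((fun=> 0) : cochain R T n) = (fun=> 0).
Proof. by apply/funext => x; rewrite /dcob big1// => i _; rewrite mulr0. Qed.

Lemma BX_CX n al : BX e dist mu n al -> CX e dist mu n al.
Proof. by case: n al => [|n] al []. Qed.

Lemma BX0 n : BX e dist mu n (fun=> 0).
Proof.
case: n => [|n]; first by split; [exact: CX0|exact: null0].
split; first exact: CX0.
by exists (fun=> 0); split; [exact: CX0|rewrite dcob0 csubrr; exact: null0].
Qed.

Lemma BX_BXbar n al : BX e dist mu n al -> BXbar e dist mu n al.
Proof.
move=> bal; split; first exact: BX_CX.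
by move=> r eps r0 eps0; exists al => //; rewrite csubrr sqnorm0 lte_fin.
Qed.

End cochain_lifting.

(** * Maps of quotients induced by a bounded cochain map *)

Section cochain_map.
Context {R : realType} {TG TH : ptopologicalType}.
Variables (eG : TG) (dG : TG -> TG -> R)
  (muG : {sigma_finite_measure set (Borel TG) -> \bar R}).
Variables (eH : TH) (dH : TH -> TH -> R)
  (muH : {sigma_finite_measure set (Borel TH) -> \bar R}).
Hypothesis csG : @coarse_space _ (Borel TG) R dG muG.
Hypothesis csH : @coarse_space _ (Borel TH) R dH muH.
Variable Phi : forall n, cochain R TG n -> cochain R TH n.
Hypothesis Phi_CX : forall n al, CX eG dG muG n al -> CX eH dH muH n (Phi al).
Hypothesis Phi_lin : forall n al be c, CX eG dG muG n al -> CX eG dG muG n be ->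
  Phi (fun x => al x + c * be x) = (fun y => Phi al y + c * Phi be y).
Hypothesis Phi_dcob : forall n (al : cochain R TG n), CX eG dG muG n al ->
  Phi (dcob al) = dcob (Phi al).
Hypothesis Phi_sqnorm : forall n r, exists r' C : R, [/\ 0 < r', 0 <= C &
  forall al : cochain R TG n, CX eG dG muG n al ->
    (sqnorm eH dH muH r (Phi al) <= C%:E * sqnorm eG dG muG r' al)%E].

Lemma Phi_csub n (al be : cochain R TG n) :
  CX eG dG muG n al -> CX eG dG muG n be ->
  Phi (csub al be) = csub (Phi al) (Phi be).
Proof. by move=> a b; rewrite csubE Phi_lin// csubE. Qed.

Lemma Phi_null n (al : cochain R TG n) : CX eG dG muG n al ->
  null_cochain eG dG muG al -> null_cochain eH dH muH (Phi al).
Proof.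
move=> cal nal r r0; have [r' [C [r'0 C0 h]]] := Phi_sqnorm n r.
have := h _ cal; rewrite nal// mule0 => h0; apply/eqP; rewrite eq_le h0/=.
by rewrite sqnormE energy_ge0.
Qed.

Lemma Phi_ZX n (al : cochain R TG n) :
  ZX eG dG muG n al -> ZX eH dH muH n (Phi al).
Proof.
case=> cal nal; split; first exact: Phi_CX.
rewrite -(Phi_dcob cal); exact: (Phi_null (CX_dcob csG cal) nal).
Qed.

Lemma Phi_BX n (al : cochain R TG n) :
  BX eG dG muG n al -> BX eH dH muH n (Phi al).
Proof.
case: n al => [|n] al; first by case=> cal nal; split; [exact: Phi_CX|exact: Phi_null].
case=> cal [be [cbe nbe]]; split; first exact: Phi_CX.
exists (Phi be); split; first exact: Phi_CX.
have cd := CX_dcob csG cbe.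
rewrite -(Phi_dcob cbe) -(Phi_csub cal cd).
exact: (Phi_null (CX_csub csG cal cd) nbe).
Qed.

Lemma Phi_BXbar n (al : cochain R TG n) :
  BXbar eG dG muG n al -> BXbar eH dH muH n (Phi al).
Proof.
case=> cal hal; split; first exact: Phi_CX.
move=> r eps r0 eps0; have [r' [C [r'0 C0 h]]] := Phi_sqnorm n r.
(* Unlike [C], the constant [C + 1] is surely nonzero, so the tolerance can be divided by it. *)
have C1 : 0 < C + 1 by rewrite ltr_wpDl.
have [be bbe he] := hal r' (eps / (C + 1)) r'0 (divr_gt0 eps0 C1).
have cbe := BX_CX bbe; exists (Phi be); first exact: Phi_BX.
rewrite -(Phi_csub cal cbe); apply: le_lt_trans (h _ (CX_csub csG cal cbe)) _.
apply: (@le_lt_trans _ _ ((C + 1)%:E * sqnorm eG dG muG r' (csub al be))%E).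
  by rewrite lee_wpmul2r ?lee_fin ?lerDl// sqnormE energy_ge0.
by rewrite -lte_pdivlMl// -EFinM mulrC.
Qed.

Section quotient.
Variables (n : nat) (SG : set (cochain R TG n)) (SH : set (cochain R TH n)).
Hypothesis SG_CX : forall al, SG al -> CX eG dG muG n al.
Hypothesis SH0 : SH (fun=> 0).
Hypothesis Phi_S : forall al, SG al -> SH (Phi al).

(** [SG] and [SH] stand for [BX] or [BXbar] on both sides. Linearity holds exactly, so its defect is
    the zero cochain. *)
Lemma Phi_quotient_linear :
  quotient_linear (ZX eG dG muG n) SG (ZX eH dH muH n) SH (@Phi n).
Proof.
split.
- exact: Phi_ZX.
- move=> al be [cal _] [cbe _] /Phi_S.
  by rewrite -/(csub al be) (Phi_csub cal cbe).
- move=> al be c [cal _] [cbe _].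
  have -> : (fun y => Phi (fun x => al x + c * be x) y - (Phi al y + c * Phi be y)) =
      (fun=> 0) by apply/funext => y; rewrite (Phi_lin _ cal cbe) subrr.
  exact: SH0.
Qed.

(** Every competitor [be] in the infimum for [al] yields the competitor [Phi be] in the infimum for
    [Phi al], at the cost of the constant for cochains. *)
Lemma Phi_quotient_continuous r : 0 < r -> exists r' C : R, [/\ 0 < r', 0 <= C &
  forall al, ZX eG dG muG n al ->
    (qsqnorm eH dH muH SH r (Phi al) <= C%:E * qsqnorm eG dG muG SG r' al)%E].
Proof.
move=> r0; have [r' [C [r'0 C0 h]]] := Phi_sqnorm n r.
have C1 : 0 < C + 1 by rewrite ltr_wpDl.
exists r', (C + 1); split => //; first exact: ltW.
move=> al [cal _]; rewrite -lee_pdivrMl//; apply: le_ereal_inf_tmp => _ [be sbe <-].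
have cbe := SG_CX sbe; rewrite lee_pdivrMl//.
apply: (@le_trans _ _ (sqnorm eH dH muH r (csub (Phi al) (Phi be)))).
  by apply: ereal_inf_lbound; exists (Phi be) => //; exact: Phi_S.
rewrite -(Phi_csub cal cbe); apply: le_trans (h _ (CX_csub csG cal cbe)) _.
by rewrite lee_wpmul2r ?lee_fin ?lerDl// sqnormE energy_ge0.
Qed.

End quotient.
End cochain_map.

(** * Kernels of coarse equivalences between groups *)

(** The common value [c] in [ns_unit] normalizes all ball kernels at once, which bounds them by the
    inverse of [c]. *)
Record netted_space d (T : measurableType d) (R : realType) (dist : T -> T -> R)
    (mu : {sigma_finite_measure set T -> \bar R}) (D : nat -> T) (c : R) : Prop := {
  ns_cs : coarse_space dist mu;
  ns_ge0 : forall x y, 0 <= dist x y;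
  ns_net : forall x, exists i, dist x (D i) < 1;
  ns_c0 : 0 < c;
  ns_unit : forall x, mu [set y | (dist x y <= 1)%R] = c%:E }.

Section coarse_map_kernel.
Context {d d' : measure_display} {S : measurableType d} {T : measurableType d'}
  {R : realType}.
Variables (dS : S -> S -> R) (nu : {sigma_finite_measure set S -> \bar R})
  (DS : nat -> S) (cS : R).
Variables (dT : T -> T -> R) (mu : {sigma_finite_measure set T -> \bar R})
  (DT : nat -> T) (cT : R).
Hypothesis nsS : netted_space dS nu DS cS.
Hypothesis nsT : netted_space dT mu DT cT.
Variables (g : S -> T).

(** Rounding to a sequence is what makes the kernel measurable: [g] is arbitrary, but
    [g (net_point s)] is constant on each of countably many measurable cells. *)
Definition net_index s : nat := ex_minn (ns_net nsS s).

Definition net_point s : S := DS (net_index s).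

Lemma net_point_dist s : dS s (net_point s) < 1.
Proof. by rewrite /net_point /net_index; case: ex_minnP. Qed.

Lemma measurable_net_index i : measurable [set s | net_index s = i].
Proof.
have mb j : measurable [set s | dS s (DS j) < 1].
  have mds := measurableT_comp (cs_meas (ns_cs nsS)) (pair2_measurable (DS j)).
  have := mds measurableT _ (measurable_itv `]-oo, 1[); rewrite setTI.
  by congr measurable; apply/seteqP; split => s /=; rewrite in_itv.
rewrite (_ : [set s | _] = [set s | dS s (DS i) < 1] `&`
  \bigcap_j (if (j < i)%N then ~` [set s | dS s (DS j) < 1] else setT)).
  apply: measurableI => //; apply: bigcapT_measurable => j.
  by case: ifP => // _; exact: measurableC.
apply/seteqP; split => s /=.
  rewrite /net_index; case: ex_minnP => m sm min <-; split => // j _.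
  by case: ifP => //= jm sj; have := min _ sj; rewrite leqNgt jm.
rewrite /net_index; case: ex_minnP => m sm min [si h].
apply/eqP; rewrite eqn_leq (min _ si)/= leqNgt; apply/negP => mi.
by have := h m I; rewrite mi.
Qed.

Definition ball_kernel (s : S) (t : T) : \bar R :=
  ((cT^-1)%:E * (\1_[set t | (dT (g (net_point s)) t <= 1)%R] t)%:E)%E.

Lemma ball_kernel_supp s t : ball_kernel s t != 0%E -> dT (g (net_point s)) t <= 1.
Proof.
rewrite /ball_kernel indicE; case: (boolP (t \in _)) => [|_]; first by rewrite inE.
by rewrite mule0 eqxx.
Qed.

Variable f : T -> S.
Hypothesis lg : coarse_lipschitz dS dT g.
Hypothesis lf : coarse_lipschitz dT dS f.
Hypothesis cfg : close_maps dS (fun s => f (g s)) id.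

Lemma net_point_dist2 r s s' : dS s s' <= r ->
  dS (net_point s) (net_point s') <= r + 2.
Proof.
move=> ss'; have := net_point_dist s; have := net_point_dist s'.
have := cs_tri (ns_cs nsS) (net_point s) s (net_point s').
have := cs_tri (ns_cs nsS) s s' (net_point s').
rewrite (cs_sym (ns_cs nsS) (net_point s) s); lra.
Qed.

Lemma coarse_kernel_ball : exists C, coarse_kernel dS nu dT mu ball_kernel C.
Proof.
have csT := ns_cs nsT; have csS := ns_cs nsS.
have cT0 := ns_c0 nsT; have cTi : 0 <= cT^-1 by rewrite invr_ge0 ltW.
have [a [[a0 amono _] ga]] := lg; have [b [[b0 bmono _] fb]] := lf.
have [E cE] := cfg.
(* If [s0] and [s] both reach [t], their net points have images under [g] at most 2 apart, hence at
   most [b 2] apart after [f]; undoing [f] after [g] costs [E] twice, and returning from the net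
   costs 1 twice. *)
pose rho := 2 + 2 * E + b 2.
have [Cr bCr] := cs_ball csS rho.
have Cr0 : 0 <= Cr.
  by rewrite -lee_fin; exact: le_trans (measure_ge0 _ _) (bCr point).
have mbT x r : measurable [set y | dT x y <= r] by exact: (measurable_ball (cs_meas csT)).
have mA : measurable [set p : S * T | dT (g (net_point p.1)) p.2 <= 1].
  rewrite (_ : [set p | _] = \bigcup_i
    ([set s | net_index s = i] `*` [set t | dT (g (DS i)) t <= 1])).
    apply: bigcupT_measurable => i.
    by apply: measurableX => //; exact: measurable_net_index.
  apply/seteqP; split => [[s t] /= h|[s t] [i _ [/= <-]]//].
  by exists (net_index s).
have mA1 t : measurable [set s | dT (g (net_point s)) t <= 1].
  have := @pair2_measurable _ _ S T t measurableT _ mA; rewrite setTI.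
  by [].
(* [cT^-1] bounds the kernel, and [cT^-1 * Cr] its integral over [s]. *)
exists (cT^-1 * (1 + Cr)); split.
- apply: measurable_funeM; apply/measurable_EFinP.
  rewrite (_ : (fun p : S * T => _) =
    \1_[set p : S * T | dT (g (net_point p.1)) p.2 <= 1]).
    exact: measurable_indic.
  by apply/funext => -[s t]; rewrite !indicE; congr ((nat_of_bool _)%:R);
    apply/idP/idP; rewrite !inE.
- by move=> s t; rewrite mule_ge0// lee_fin.
- move=> s t; rewrite /ball_kernel -EFinM lee_fin ler_wpM2l// indicE.
  by case: (_ \in _); rewrite ?lerDl// addr_ge0.
- move=> s; rewrite /ball_kernel ge0_integralZlT//; last exact/measurable_EFinP/measurable_indic.
  rewrite integral_indic// setIT.
  transitivity ((cT^-1)%:E * cT%:E)%E; first by congr (_ * _)%E; exact: (ns_unit nsT).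
  by rewrite -EFinM mulVf// gt_eqF.
- move=> t; rewrite /ball_kernel.
  under eq_integral => s _.
    rewrite (_ : \1_[set t | dT (g (net_point s)) t <= 1] t =
      \1_[set s | dT (g (net_point s)) t <= 1] s); last first.
      by rewrite !indicE; congr ((nat_of_bool _)%:R); apply/idP/idP; rewrite !inE.
    over.
  rewrite ge0_integralZlT//; last exact/measurable_EFinP/measurable_indic.
  rewrite integral_indic// setIT EFinM lee_wpmul2l//.
  have [/eqP ->|/set0P[s0 /= hs0]] := boolP ([set s | dT (g (net_point s)) t <= 1] == set0).
    by rewrite measure0 lee_fin addr_ge0.
  apply: (@le_trans _ _ (nu [set s | (dS s0 s <= rho)%R])); last first.
    by apply: le_trans (bCr _) _; rewrite lee_fin lerDr.
  apply: le_measure; rewrite ?inE//.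
    exact: (measurable_ball (cs_meas csS)).
  move=> s /= hs.
  have g2 : dT (g (net_point s0)) (g (net_point s)) <= 2.
    have := cs_tri csT (g (net_point s0)) t (g (net_point s)).
    by rewrite (cs_sym csT t); lra.
  have f2 : dS (f (g (net_point s0))) (f (g (net_point s))) <= b 2.
    apply: le_trans (fb _ _) _; apply: bmono => //; exact: ns_ge0 nsT _ _.
  have h0 := net_point_dist s0; have h1 := net_point_dist s.
  have e0 := cE (net_point s0); have e1 := cE (net_point s).
  have t1 := cs_tri csS s0 (net_point s0) s.
  have t2 := cs_tri csS (net_point s0) (f (g (net_point s0))) s.
  have t3 := cs_tri csS (f (g (net_point s0))) (f (g (net_point s))) s.
  have t4 := cs_tri csS (f (g (net_point s))) (net_point s) s.
  move: t2 t4; rewrite (cs_sym csS (net_point s0) (f _)) (cs_sym csS (net_point s) s).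
  by move: e0 e1 => /= e0 e1 t2 t4; rewrite /rho; lra.
(* Rounding to the net adds 2 to [r]; passing from the centres to points of the unit balls adds 2 to
   the result. *)
- move=> r; exists (2 + a (r + 2)) => s s' t t' /ball_kernel_supp k1 /ball_kernel_supp k2 ss'.
  have h : dT (g (net_point s)) (g (net_point s')) <= a (r + 2).
    apply: le_trans (ga _ _) _; apply: amono; first exact: ns_ge0 nsS _ _.
    exact: net_point_dist2.
  have t1 := cs_tri csT t (g (net_point s)) t'.
  have t2 := cs_tri csT (g (net_point s)) (g (net_point s')) t'.
  by move: t1; rewrite (cs_sym csT t (g _)); lra.
Qed.

End coarse_map_kernel.

(** * Balls and Haar measure of a metric group *)

Section group_netted.
Context {R : realType} {T : ptopologicalType}.
Variables (mul : T -> T -> T) (inv : T -> T) (e : T) (dist : T -> T -> R)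
  (mu : {measure set (Borel T) -> \bar R}).
Hypothesis gT : lcsc_group mul inv e.
Hypothesis mT : lipc_metric mul dist.
Hypothesis hT : unimodular_haar mul mu.

Let dist_cont x : continuous (dist x).
Proof.
case: mT => _ _ cd _ y.
apply: (@continuous_comp _ _ _ (fun y => (x, y)) (fun p : T * T => dist p.1 p.2)).
  by apply: cvg_pair; [exact: cvg_cst|exact: cvg_id].
exact: cd.
Qed.

Lemma Borel_open (A : set T) : open A -> measurable (A : set (Borel T)).
Proof. by move=> oA; exact: sub_sigma_algebra. Qed.

Lemma measurable_dist1 x : measurable_fun setT (dist x : Borel T -> R).
Proof.
apply: (measurability _ (RGenOpens.measurableE R)) => _ [_ [a [b ->]] <-].
rewrite setTI; apply: Borel_open; apply: open_comp => [y _|]; first exact: dist_cont.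
exact: interval_open.
Qed.

Lemma group_dense : exists D : nat -> T, forall x eps, 0 < eps ->
  exists i, dist x (D i) < eps.
Proof.
case: gT => _ _ _ _ [B /countable_injP[idx injB] [oB bB]].
(* The n-th point is taken from the base set numbered [n]; the default [point] is used when there is
   none. *)
exists (fun n => xget point [set y | exists2 U, B U /\ U y & idx U = n]) => x eps eps0.
have : nbhs x [set y | dist x y < eps].
  apply: open_nbhs_nbhs; split; last first.
    by rewrite /=; case: mT => [[_ d0 _ _] _ _ _]; rewrite (d0 x x).2.
  rewrite (_ : [set y | _] = dist x @^-1` `]-oo, eps[%classic).
    by apply: open_comp => [y _|]; [exact: dist_cont|exact: interval_open].
  by apply/seteqP; split => y /=; rewrite in_itv.
move=> /bB[U [BU Ux] Usub]; exists (idx U).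
case: xgetP => [y _ [V [BV Vy] VU]|/(_ x)[]]; last by exists U.
by apply: Usub; rewrite -(injB V U)// inE.
Qed.

(** Continuity of [dist] concerns the product topology, while the sigma-algebra here is the product
    of the Borel ones. The dense sequence bridges the two: [dist x y < r] holds exactly when
    [dist (D i) x + dist (D i) y < r] for some [i], which is a countable union. *)
Lemma measurable_dist2 :
  measurable_fun setT (fun p : Borel T * Borel T => dist p.1 p.2).
Proof.
have [[_ _ dC dtri] _ _ _] := mT; have [D hD] := group_dense.
apply: (measurability _ (RGenInftyO.measurableE R)) => _ [_ [r ->] <-]; rewrite setTI.
rewrite (_ : _ @^-1` _ = \bigcup_i [set p : Borel T * Borel T |
  dist (D i) p.1 + dist (D i) p.2 < r]).
  apply: bigcupT_measurable => i.
  have m : measurable_fun setT (fun p : Borel T * Borel T =>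
      dist (D i) p.1 + dist (D i) p.2).
    apply: measurable_funD.
      exact: (measurableT_comp (measurable_dist1 (D i)) measurable_fst).
    exact: (measurableT_comp (measurable_dist1 (D i)) measurable_snd).
  have := m measurableT _ (measurable_itv `]-oo, r[); rewrite setTI.
  by congr measurable; apply/seteqP; split => p /=; rewrite in_itv.
apply/seteqP; split => [[x y] /=|[x y] [i _ /=]]; rewrite in_itv /=.
  move=> xy; have [|i hi] := hD y ((r - dist x y) / 2); first by rewrite divr_gt0 ?subr_gt0.
  exists i => //=; have := dtri x y (D i).
  by rewrite (dC (D i) x) (dC (D i) y); move: hi; rewrite ltr_pdivlMr//; lra.
by apply: le_lt_trans; rewrite (dC (D i) x); exact: dtri.
Qed.

Lemma measurable_group_ball x r : measurable ([set y | dist x y <= r] : set (Borel T)).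
Proof.
have := measurable_dist1 x measurableT (measurable_itv `]-oo, r]); rewrite setTI.
by congr measurable; apply/seteqP; split => y /=; rewrite in_itv.
Qed.

Lemma group_ball_measure x r : mu [set y | dist x y <= r] = mu [set y | dist e y <= r].
Proof.
case: gT => -[mA m1 mV] _ _ _ _; case: mT => _ li _ _; case: hT => _ _ linv _.
rewrite -(linv x _ (measurable_group_ball e r)); congr (mu _).
apply/seteqP; split => [y /= xy|_ [y /= ey <-]].
  exists (mul (inv x) y); last by rewrite mA (mV x).2 (m1 y).1.
  by rewrite /= -(li x) mA (mV x).2 (m1 x).2 (m1 y).1.
by rewrite -{1}(m1 x).2 li.
Qed.

Lemma group_ball_lty x r : (mu [set y | (dist x y <= r)%R] < +oo)%E.
Proof. by case: hT => _ fin _ _; apply: fin; case: mT. Qed.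

Lemma group_sigma_finite : sigma_finite [set: Borel T] mu.
Proof.
exists (fun n => [set y | dist e y <= n%:R]).
  apply/seteqP; split => y // _; exists (Num.bound (dist e y)) => //=.
  case: mT => [[d0 _ _ _] _ _ _].
  by have := archi_boundP (d0 e y) => /ltW.
by move=> n; split; [exact: measurable_group_ball|exact: group_ball_lty].
Qed.

(** Unit balls around a dense sequence cover the group and have equal measure; if that were 0, the
    Haar measure would vanish. *)
Lemma group_ball_gt0 : (0 < mu [set y | (dist e y <= 1)%R])%E.
Proof.
rewrite lt_neqAle measure_ge0 andbT; apply/eqP => /esym h0.
have [D hD] := group_dense; case: hT => /eqP mT0 _ _ _; apply: mT0.
apply/eqP; rewrite eq_le measure_ge0 andbT.
apply: (@le_trans _ _ (\sum_(0 <= i <oo) mu [set y | (dist (D i) y <= 1)%R])%E).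
  apply: measure_sigma_subadditive => // [i|y _]; first exact: measurable_group_ball.
  have [i hi] := hD y 1 ltr01; exists i => //=; apply/ltW.
  by case: mT => [[_ _ dC _] _ _ _]; rewrite dC.
by rewrite eseries0// => i _ _; rewrite group_ball_measure.
Qed.

End group_netted.

(** Tonelli is applied to bundled sigma-finite measures, while the theorem quantifies over bare
    ones; the equality lets one be substituted for the other. *)
Lemma sigma_finite_measure_ex (R : realType) d (T : measurableType d)
    (mu : {measure set T -> \bar R}) : sigma_finite setT mu ->
  exists mu' : {sigma_finite_measure set T -> \bar R},
    mu = mu' :> {measure set T -> \bar R}.
Proof.
move=> h; pose s1 := isSFinite.Build d T R mu (sfinite_measure_sigma_finite h).
pose s2 := isSigmaFinite.Build d T R mu h.
pose mu' : {sigma_finite_measure set T -> \bar R} :=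
  HB.pack (Measure.sort mu) s1 s2.
by exists mu'; rewrite {}/mu' {}/s1 {}/s2; case: mu h => m [].
Qed.

Lemma group_netted_space (R : realType) (T : ptopologicalType)
    (mul : T -> T -> T) (inv : T -> T) (e : T) (dist : T -> T -> R)
    (mu : {sigma_finite_measure set (Borel T) -> \bar R}) :
  lcsc_group mul inv e -> lipc_metric mul dist -> unimodular_haar mul mu ->
  exists D c, @netted_space _ (Borel T) R dist mu D c.
Proof.
move=> gT mT hT; have [D hD] := group_dense gT mT.
exists D, (fine (mu [set y | dist e y <= 1])).
have [[d0 _ dC dtri] _ _ _] := mT.
have fin x r := group_ball_lty mT hT x r.
have fn r : mu [set y | dist e y <= r] \is a fin_num.
  by rewrite ge0_fin_numE; [exact: fin|exact: measure_ge0].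
split => //.
- split => //; first exact: (measurable_dist2 gT mT).
  move=> r; exists (fine (mu [set y | dist e y <= r])) => x.
  by rewrite fineK//; have -> := group_ball_measure gT mT hT x r.
- by move=> x; exact: hD.
- by rewrite fine_gt0//; apply/andP; split; [exact: (group_ball_gt0 gT mT hT)|exact: fin].
- by move=> x; rewrite fineK//; exact: (group_ball_measure gT mT hT x 1).
Qed.

(** * Cochain maps defined by kernels *)

Section kernel_cochain_map.
Context {R : realType} {TG TH : ptopologicalType}.
Variables (eG : TG) (dG : TG -> TG -> R)
  (muG : {sigma_finite_measure set (Borel TG) -> \bar R}).
Variables (eH : TH) (dH : TH -> TH -> R)
  (muH : {sigma_finite_measure set (Borel TH) -> \bar R}).
Hypothesis csG : @coarse_space _ (Borel TG) R dG muG.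
Hypothesis csH : @coarse_space _ (Borel TH) R dH muH.
Variables (K : Borel TH -> Borel TG -> \bar R) (C : R).
Hypothesis ckK : @coarse_kernel _ _ (Borel TH) (Borel TG) R dH muH dG muG K C.

Definition kernel_map (K : Borel TH -> Borel TG -> \bar R) n (al : cochain R TG n) :
    cochain R TH n :=
  fun h => @avg _ _ (Borel TH) (Borel TG) R muG eG K n (lift_cochain al) (extend_tuple h).

Lemma lift_kernel_map n (al : cochain R TG n) : lift_cochain (kernel_map K al) =
  @avg _ _ (Borel TH) (Borel TG) R muG eG K n (lift_cochain al).
Proof.
apply/funext => x; apply: (avg_ext _ ckK) => i ni.
exact: extend_tuple_restrict.
Qed.

Lemma kernel_map_CX n al : CX eG dG muG n al -> CX eH dH muH n (kernel_map K al).
Proof.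
by move=> /CXP lal; apply/CXP; rewrite lift_kernel_map; exact: (l2c_avg _ csG ckK lal).
Qed.

(** An equality of functions and not only of classes, because averages of l^2 cochains converge at
    every point. *)
Lemma kernel_map_lin n al be c : CX eG dG muG n al -> CX eG dG muG n be ->
  kernel_map K (fun x => al x + c * be x) =
  (fun y => kernel_map K al y + c * kernel_map K be y).
Proof.
move=> /CXP la /CXP lb; apply/funext => y; rewrite /kernel_map.
rewrite -(avgZ csG ckK _ _ lb) -(avgD csG ckK _ la)//.
exact: l2cZ.
Qed.

Lemma kernel_map_dcob n (al : cochain R TG n) : CX eG dG muG n al ->
  kernel_map K (dcob al) = dcob (kernel_map K al).
Proof.
move=> /CXP la; apply/funext => y.
rewrite -[RHS]lift_cochain_extend lift_dcob lift_kernel_map.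
exact: (ncob_avg csG ckK _ la).
Qed.

Lemma kernel_map_sqnorm n r : exists r' C' : R, [/\ 0 < r', 0 <= C' &
  forall al : cochain R TG n, CX eG dG muG n al ->
    (sqnorm eH dH muH r (kernel_map K al) <= C'%:E * sqnorm eG dG muG r' al)%E].
Proof.
have [r' [C' [r'0 C'0 h]]] := energy_avg (eH : Borel TH) (eG : Borel TG) csG ckK n r.
exists r', C'; split => // al /CXP[mal _].
by rewrite !sqnormE lift_kernel_map; exact: h.
Qed.

End kernel_cochain_map.

Section homotopy_inverse.
Context {R : realType} {TG TH : ptopologicalType}.
Variables (eG : TG) (dG : TG -> TG -> R)
  (muG : {sigma_finite_measure set (Borel TG) -> \bar R}).
Variables (eH : TH) (dH : TH -> TH -> R)
  (muH : {sigma_finite_measure set (Borel TH) -> \bar R}).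
Variables (DG : nat -> TG) (cG : R) (DH : nat -> TH) (cH : R).
Hypothesis nsG : @netted_space _ (Borel TG) R dG muG DG cG.
Hypothesis nsH : @netted_space _ (Borel TH) R dH muH DH cH.
Variables (f : TG -> TH) (g : TH -> TG).
Hypothesis lf : coarse_lipschitz dG dH f.
Hypothesis lg : coarse_lipschitz dH dG g.
Hypothesis cgf : close_maps dG (fun x => g (f x)) id.
Hypothesis cfg : close_maps dH (fun y => f (g y)) id.

Let csG := ns_cs nsG.
Let csH := ns_cs nsH.
Let Kf : Borel TG -> Borel TH -> \bar R := 
  @ball_kernel _ _ (Borel TG) (Borel TH) R dG muG DG cG dH cH nsG f.
Let Kg : Borel TH -> Borel TG -> \bar R := 
  @ball_kernel _ _ (Borel TH) (Borel TG) R dH muH DH cH dG cG nsH g.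

Lemma kcomp_ball_supp : exists D : R, forall x z,
  kcomp muH Kf Kg x z != 0%E -> dG x z <= D.
Proof.
have [b [[_ bmono _] gb]] := lg; have [E cE] := cgf.
(* With [p] and [q] the net points of [x] and [y], the path [x], [p], [g (f p)], [g q], [z] has
   steps of length at most 1, [E], [b 2] and 1. *)
exists (2 + E + b 2) => x z /kcomp_supp[y k1 k2].
have {}k1 := @ball_kernel_supp _ _ (Borel TG) (Borel TH) R dG muG DG cG dH cH nsG f x y k1.
have {}k2 := @ball_kernel_supp _ _ (Borel TH) (Borel TG) R dH muH DH cH dG cG nsH g y z k2.
have h1 := net_point_dist nsG x; have h2 := net_point_dist nsH y.
move: k1 k2 h1 h2; set p := net_point nsG x; set q := net_point nsH y => k1 k2 h1 h2.
have fq : dH (f p) q <= 2 by have := cs_tri csH (f p) y q; lra.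
have gq : dG (g (f p)) (g q) <= b 2.
  by apply: le_trans (gb _ _) _; apply: bmono => //; exact: (ns_ge0 nsH).
have e1 := cE p; have t1 := cs_tri csG x p z; have t2 := cs_tri csG p (g (f p)) z.
have t3 := cs_tri csG (g (f p)) (g q) z.
by move: t2; rewrite (cs_sym csG p (g _)); move: e1 => /= e1 t2; lra.
Qed.

Lemma kernel_map_homotopy n al : ZX eG dG muG n al ->
  BX eG dG muG n
    (csub (kernel_map eH muH Kf (kernel_map eG muG Kg al)) al).
Proof.
have [Cf ckf] : exists C,
    @coarse_kernel _ _ (Borel TG) (Borel TH) R dG muG dH muH Kf C.
  exact: (coarse_kernel_ball nsG nsH lf lg cgf).
have [Cg ckg] : exists C,
    @coarse_kernel _ _ (Borel TH) (Borel TG) R dH muH dG muG Kg C.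
  exact: (coarse_kernel_ball nsH nsG lg lf cfg).
have [Ck ckk] := coarse_kernel_comp ckf ckg.
have [D supD] := kcomp_ball_supp.
case=> cal nal; have lal := (CXP eG dG muG al).1 cal.
have cPP : CX eG dG muG n (kernel_map eH muH Kf (kernel_map eG muG Kg al)).
  by apply: (kernel_map_CX _ csH ckf); exact: (kernel_map_CX _ csG ckg).
have liftPP : lift_cochain (kernel_map eH muH Kf (kernel_map eG muG Kg al)) =
    avg muG (eG : Borel TG) (kcomp muH Kf Kg) n (lift_cochain al).
  rewrite (lift_kernel_map _ ckf) (lift_kernel_map _ ckg).
  by apply/funext => x; exact: (avg_avg _ csG ckf ckg _ lal).
have dep := @lift_depends R TG n al.
have nal' r : 0 < r -> 
    @energy _ (Borel TG) R dG muG eG r n.+1 (ncob n (lift_cochain al)) = 0%E.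
  by move=> r0; rewrite -lift_dcob -sqnormE; exact: nal.
have cd := CX_csub csG cPP cal.
(* [BX] consists of null cochains in degree 0 and of coboundaries up to null cochains above. *)
case: n al cal nal lal cPP liftPP dep nal' cd => [|n] al cal nal lal cPP liftPP dep nal' cd.
  split=> // r r0; rewrite sqnormE.
  have -> : lift_cochain (csub (kernel_map eH muH Kf (kernel_map eG muG Kg al)) al) =
      (fun x => avg muG (eG : Borel TG) (kcomp muH Kf Kg) 0 (lift_cochain al) x -
        lift_cochain al x) by rewrite -liftPP.
  exact: (homotopy_cocycle0 csG ckk supD lal dep nal' r0).
(* The primitive is the prism operator applied to [al]: since [al] is a cocycle, only the term [d s]
   of the homotopy is left. *)
split=> //; pose ga : cochain R TG n := fun x =>
  prism_op muG (eG : Borel TG) (kcomp muH Kf Kg) n (lift_cochain al) (extend_tuple x).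
have lga : lift_cochain ga = prism_op muG (eG : Borel TG) (kcomp muH Kf Kg) n (lift_cochain al).
  apply/funext => x; apply: (prism_op_ext _ ckk) => i ni.
  exact: extend_tuple_restrict.
exists ga; split.
  by apply/CXP; rewrite lga; exact: (l2c_prism_op csG ckk supD lal).
move=> r r0; rewrite sqnormE.
have -> : lift_cochain (csub
      (csub (kernel_map eH muH Kf (kernel_map eG muG Kg al)) al) (dcob ga)) =
    (fun x => avg muG (eG : Borel TG) (kcomp muH Kf Kg) n.+1 (lift_cochain al) x -
      lift_cochain al x - ncob n (prism_op muG (eG : Borel TG) (kcomp muH Kf Kg) n
        (lift_cochain al)) x) by rewrite -liftPP -lga.
exact: (homotopy_cocycleS csG ckk supD lal dep nal' r0).
Qed.

End homotopy_inverse.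

(* G = (TG, mulG, invG, eG) and H = (TH, mulH, invH, eH): unimodular lcsc
   groups with left-invariant proper continuous metrics dG, dH and Haar
   measures muG, muH.  If G and H are coarsely equivalent then, for every
   n, HX^n_(2)(G) ~= HX^n_(2)(H) and the reduced cohomologies are
   isomorphic (as topological vector spaces). *)
Theorem theorem4p2 (R : realType)
    (TG : ptopologicalType) (mulG : TG -> TG -> TG) (invG : TG -> TG) (eG : TG)
    (dG : TG -> TG -> R) (muG : {measure set (Borel TG) -> \bar R})
    (TH : ptopologicalType) (mulH : TH -> TH -> TH) (invH : TH -> TH) (eH : TH)
    (dH : TH -> TH -> R) (muH : {measure set (Borel TH) -> \bar R}) :
  lcsc_group mulG invG eG -> lipc_metric mulG dG -> unimodular_haar mulG muG ->
  lcsc_group mulH invH eH -> lipc_metric mulH dH -> unimodular_haar mulH muH ->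
  coarse_equivalent dG dH ->
  forall n : nat,
    top_iso_quot eG dG muG eH dH muH
      (ZX eG dG muG n) (BX eG dG muG n) (ZX eH dH muH n) (BX eH dH muH n) /\
    top_iso_quot eG dG muG eH dH muH
      (ZX eG dG muG n) (BXbar eG dG muG n) (ZX eH dH muH n) (BXbar eH dH muH n).
Proof.
move=> gG mG hG gH mH hH [f [g [lf lg cgf cfg]]] n.
have [muG' EG] := sigma_finite_measure_ex (group_sigma_finite eG mG hG).
have [muH' EH] := sigma_finite_measure_ex (group_sigma_finite eH mH hH).
subst muG muH.
have [DG [cG nsG]] := group_netted_space gG mG hG.
have [DH [cH nsH]] := group_netted_space gH mH hH.
have csG := ns_cs nsG; have csH := ns_cs nsH.
have [Cf ckf] := coarse_kernel_ball nsG nsH lf lg cgf.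
have [Cg ckg] := coarse_kernel_ball nsH nsG lg lf cfg.
have homG := @kernel_map_homotopy R TG TH eG dG muG' eH dH muH' DG cG DH cH nsG nsH
  f g lf lg cgf cfg n.
have homH := @kernel_map_homotopy R TH TG eH dH muH' eG dG muG' DH cH DG cG nsH nsG
  g f lg lf cfg cgf n.
have CXG := kernel_map_CX (eG := eG) eH csG ckg.
have CXH := kernel_map_CX (eG := eH) eG csH ckf.
have linG := kernel_map_lin (eG := eG) csG ckg.
have linH := kernel_map_lin (eG := eH) csH ckf.
have dG' := kernel_map_dcob (eG := eG) csG ckg.
have dH' := kernel_map_dcob (eG := eH) csH ckf.
have sqG := kernel_map_sqnorm eG eH csG ckg.
have sqH := kernel_map_sqnorm eH eG csH ckf.
move: homG homH CXG CXH linG linH dG' dH' sqG sqH.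
(* Pullback is contravariant: [Phi], from cochains on [G] to cochains on [H], averages against the
   kernel of [g], which goes from [H] to [G]. *)
set Phi := kernel_map eG muG' _; set Psi := kernel_map eH muH' _.
move=> homG homH CXG CXH linG linH dG' dH' sqG sqH.
(* The same pair of maps serves the unreduced and the reduced quotients. *)
split; exists (@Phi n), (@Psi n); split.
- split.
  + exact: (Phi_quotient_linear csG CXG linG dG' sqG (BX0 eH csH n)
      (Phi_BX csG CXG linG dG' sqG (n := n))).
  + exact: (Phi_quotient_linear csH CXH linH dH' sqH (BX0 eG csG n)
      (Phi_BX csH CXH linH dH' sqH (n := n))).
- by split; [exact: homG|exact: homH].
- exact: (Phi_quotient_continuous csG linG sqG (@BX_CX _ _ eG dG muG' n)
    (Phi_BX csG CXG linG dG' sqG (n := n))).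
- exact: (Phi_quotient_continuous csH linH sqH (@BX_CX _ _ eH dH muH' n)
    (Phi_BX csH CXH linH dH' sqH (n := n))).
- split.
  + exact: (Phi_quotient_linear csG CXG linG dG' sqG (BX_BXbar csH (BX0 eH csH n))
      (Phi_BXbar csG CXG linG dG' sqG (n := n))).
  + exact: (Phi_quotient_linear csH CXH linH dH' sqH (BX_BXbar csG (BX0 eG csG n))
      (Phi_BXbar csH CXH linH dH' sqH (n := n))).
(* The homotopies land in [BX], hence in its closure. *)
- split => al zal; first by apply: (BX_BXbar csG); exact: homG.
  by apply: (BX_BXbar csH); exact: homH.
- apply: (Phi_quotient_continuous csG linG sqG).
    by move=> al [].
  exact: (Phi_BXbar csG CXG linG dG' sqG (n := n)).
- apply: (Phi_quotient_continuous csH linH sqH).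
    by move=> al [].
  exact: (Phi_BXbar csH CXH linH dH' sqH (n := n)).
Qed.
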